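(* Let $d,m\in\mathbb N$, let $\odot$ be a u.a.u.-product in $\mathbf{AlgP}_{d,m}$, let $V$ be a vector space, $E=\bigl(\mathrm T(V)^{\sqcup m}\bigr)^d$, and let $\varphi_1,\varphi_2\in E^*$. Then $$\ln_\odot(\varphi_1\star\varphi_2)=\mathrm{CBH}\bigl(D(\ln_\odot(\varphi_1)),D(\ln_\odot(\varphi_2))\bigr)\big|_E .$$ If $\odot$ is symmetric, then $$\ln_\odot(\varphi_1\star\varphi_2)=\ln_\odot(\varphi_1)+\ln_\odot(\varphi_2).$$
   Context: Algebras are complex associative, not necessarily unital. $V^{*d}:=(V^* )^d=(V^d)^*$; $\varphi\circ j$ is taken componentwise. $A_1\sqcup A_2$ is the free product (coproduct of non-unital algebras) with embeddings $\iota_1,\iota_2$; $j_1\,\underline\sqcup\,j_2=(\iota_1\circ j_1)\sqcup(\iota_2\circ j_2):B_1\sqcup B_2\to A_1\sqcup A_2$. Category $\mathbf{AlgP}_{d,m}$: objects $(A,(A^{(1)},\dots,A^{(m)}),\varphi)$ with $A$ an algebra, $A^{(l)}$ subalgebras freely generating $A$ (the canonical map $A^{(1)}\sqcup\dots\sqcup A^{(m)}\to A$ is bijective), $\varphi\in A^{*d}$; morphisms $(B,\psi)\to(A,\varphi)$: algebra homomorphisms $j:B\to A$ with $j(B^{(l)})\subset A^{(l)}$ and $\psi=\varphi\circ j$. A universal product $\odot$ assigns to two objects an element $\varphi_1\odot\varphi_2\in(A_1\sqcup A_2)^{*d}$, where $A_1\sqcup A_2$ carries the subalgebras $A_1^{(l)}\sqcup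 A_2^{(l)}$, such that $(\varphi_1\odot\varphi_2)\circ(j_1\,\underline\sqcup\,j_2)=(\varphi_1\circ j_1)\odot(\varphi_2\circ j_2)$ for all algebra homomorphisms $j_i:B_i\to A_i$ with $j_i(B_i^{(l)})\subset A_i^{(l)}$. It is a u.a.u.-product if moreover $(\varphi_1\odot\varphi_2)\circ\iota_i=\varphi_i$ ($i=1,2$) and $(\varphi_1\odot\varphi_2)\odot\varphi_3=\varphi_1\odot(\varphi_2\odot\varphi_3)$; symmetric if $\varphi_1\odot\varphi_2=\varphi_2\odot\varphi_1$ under $A_1\sqcup A_2\cong A_2\sqcup A_1$. (Universal products are assumed non-degenerate: not identically zero on all alternating products of length $>1$.) $\mathrm T(V)=\bigoplus_{n\ge1}V^{\otimes n}$ is the tensor algebra without unit. It has the algebra homomorphism $\Delta:\mathrm T(V)\to\mathrm T(V)\sqcup\mathrm T(V)$ with $\Delta v=\iota_1v+\iota_2v$, $v\in V$. $\mathrm T(V)^{\sqcup m}$ is the free product of $m$ copies of $\mathrm T(V)$ (these are its $m$ distinguished subalgebras) and $\Delta^{\sqcup m}:\mathrm T(V)^{\sqcup m}\to\mathrm T(V)^{\sqcup m}\sqcup\mathrm T(V)^{\sqcup m}$ acts as $\Delta$ on each copy (from the $l$-th copy to the free product of the two $l$-th copies). For $\varphi_1,\varphi_2\in(\mathrm T(V)^{\sqcup m})^{*d}=E^*$ the convolution is $\varphi_1\star\varphi_2=(\varphi_1\odot\varphi_2)\circ\Delta^{\sqcup m}$. $\mathrm S(W)$ is the unital symmetric tensor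 algebra of $W$; for $\varphi\in W^*$, $\mathrm S(\varphi):\mathrm S(W)\to\mathbb C$ is the unital algebra homomorphism extending $\varphi$; more generally a linear map $R$ from $W$ to a commutative unital algebra extends to a unital homomorphism $\mathrm S(R)$. For each pair of algebras $A_1,A_2$ with $m$ freely generating subalgebras there is a unique map $\sigma_{A_1,A_2}:(A_1\sqcup A_2)^d\to\mathrm S(A_1^d)\otimes\mathrm S(A_2^d)$ with $\varphi_1\odot\varphi_2=(\mathrm S(\varphi_1)\otimes\mathrm S(\varphi_2))\circ\sigma_{A_1,A_2}$ for all $\varphi_i\in A_i^{*d}$. With $\mathrm D=\mathrm T(V)^{\sqcup m}$, $\mathrm S(E)$ is a commutative bialgebra with comultiplication $\mathrm S(\sigma_{\mathrm D,\mathrm D}\circ\Delta^{\sqcup m})$ ($\Delta^{\sqcup m}$ applied componentwise on $E=\mathrm D^d$) and counit $\mathrm S(0)$, denoted $\mathcal L_\odot(\mathrm T(V))$; it satisfies $\mathrm S(\varphi_1\star\varphi_2)=\mathrm S(\varphi_1)\star\mathrm S(\varphi_2)$, where on the right $\star$ is the convolution on $\mathrm S(E)^*$. With $V$ in degree $1$ it is an $\mathbb N_0$-graded Hopf algebra with degree-$0$ part $\mathbb C\mathbf 1$. For $\Phi\in\mathrm S(E)^*$ with $\Phi(\mathbf 1)=1$, $\ln_\star\Phi=\sum_{l\ge1}\frac{(-1)^{l+1}}{l}(\Phi-\mathrm S(0))^{\star l}$ (a finite sum at each point). $\ln_\odot(\varphi):=\ln_\star(\mathrm S(\varphi))|_E\in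 E^*$ is the cumulant functional of $\varphi\in E^*$. For $\psi\in E^*$, $D(\psi)\in\mathrm S(E)^*$ equals $\psi$ on $E=E^{\otimes_s1}$ and $0$ on $E^{\otimes_sn}$, $n\ne1$. $\mathrm{CBH}(x,y)=\ln(e^xe^y)=x+y+\frac12[x,y]+\frac1{12}[x,[x,y]]+\cdots$ is the Campbell–Baker–Hausdorff series, here formed with the product $\star$ on $\mathrm S(E)^*$ (finite at each point). *)

(* Defs.v *)
From HB Require Import structures.
From mathcomp Require Import all_boot all_order all_algebra.
From mathcomp Require Import finmap.
From mathcomp Require Import boolp classical_sets functions cardinality fsbigop.

Set Implicit Arguments.
Unset Strict Implicit.
Unset Printing Implicit Defensive.

Import GRing.Theory.
Local Open Scope ring_scope.
Local Open Scope quotient_scope.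

HB.mixin Record Lmodule_isNAlgebra (K : fieldType) A of GRing.Lmodule K A := {
  nmul : A -> A -> A;
  nmulA : associative nmul;
  nmul_linl : forall y, linear (nmul^~ y);
  nmul_linr : forall x, linear (nmul x)
}.

#[short(type="nalgType")]
HB.structure Definition NAlgebra (K : fieldType) :=
  {A of GRing.Lmodule K A & Lmodule_isNAlgebra K A}.

Definition lin_of (K : fieldType) (U V : lmodType K) (f : U -> V)
  (lf : linear f) : {linear U -> V} :=
  HB.pack f (GRing.isLinear.Build K U V *:%R f lf).

Definition is_nhom (K : fieldType) (A B : nalgType K) (f : A -> B) : Prop :=
  linear f /\ {morph f : x y / nmul x y}.

Record nhom (K : fieldType) (A B : nalgType K) := NHom {
  nhom_lin :> {linear A -> B};
  nhomM : {morph nhom_lin : x y / nmul x y}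
}.

Definition nhom_of (K : fieldType) (A B : nalgType K) (f : A -> B)
    (hf : is_nhom f) : nhom A B :=
  @NHom K A B (lin_of hf.1) hf.2.

Lemma is_nhomP (K : fieldType) (A B : nalgType K) (f : nhom A B) : is_nhom f.
Proof. by split; [exact: linearP | exact: nhomM]. Qed.

Section NhomComp.
Variables (K : fieldType).

Lemma nhom_id_subproof (A : nalgType K) : is_nhom (@idfun A).
Proof. by split. Qed.
Definition nhom_id (A : nalgType K) : nhom A A := nhom_of (nhom_id_subproof A).

Lemma nhom_comp_subproof (A B C : nalgType K) (g : nhom B C) (f : nhom A B) :
  is_nhom (g \o f).
Proof.
split; first exact: linearP.
by move=> x y /=; rewrite !nhomM.
Qed.
Definition nhom_comp (A B C : nalgType K) (g : nhom B C) (f : nhom A B) :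
  nhom A C := nhom_of (nhom_comp_subproof g f).

Lemma nhom_compE (A B C : nalgType K) (g : nhom B C) (f : nhom A B) x :
  nhom_comp g f x = g (f x).
Proof. by []. Qed.
End NhomComp.

(* The relations are given by the class [P] of admissible assignments of the
   generators in an arbitrary algebra; two terms are identified when they take
   the same value under every admissible assignment, so that the quotient is
   the universal algebra with an admissible assignment ([palg_lift],
   [palg_uniq]). *)

Inductive nterm (K X : Type) : Type :=
| NGen of X
| NZero
| NOpp of nterm K X
| NAdd of nterm K X & nterm K X
| NScale of K & nterm K X
| NMul of nterm K X & nterm K X.
Arguments NGen K {X}.
Arguments NZero {K X}.

HB.instance Definition _ (K X : Type) := gen_eqMixin (nterm K X).
HB.instance Definition _ (K X : Type) := gen_choiceMixin (nterm K X).

Fixpoint neval (K : fieldType) (X : Type) (B : nalgType K) (f : X -> B)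
    (t : nterm K X) : B :=
  match t with
  | NGen x => f x
  | NZero => 0
  | NOpp t => - neval f t
  | NAdd s t => neval f s + neval f t
  | NScale k t => k *: neval f t
  | NMul s t => nmul (neval f s) (neval f t)
  end.

Section Palg.
Variables (K : fieldType) (X : Type).
Variable P : forall B : nalgType K, (X -> B) -> Prop.

Definition palg_eqv : rel (nterm K X) := fun s t =>
  `[< forall (B : nalgType K) (f : X -> B), P f -> neval f s = neval f t >].

Lemma palg_eqv_refl : reflexive palg_eqv.
Proof. by move=> s; apply/asboolP. Qed.
Lemma palg_eqv_sym : symmetric palg_eqv.
Proof. by move=> s t; apply/asboolP/asboolP => h B f Pf; rewrite h. Qed.
Lemma palg_eqv_trans : transitive palg_eqv.
Proof.
by move=> t s u /asboolP h1 /asboolP h2; apply/asboolP => B f Pf; rewrite h1 ?h2.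
Qed.
Canonical palg_equiv := EquivRel palg_eqv palg_eqv_refl palg_eqv_sym palg_eqv_trans.

Definition palg_car := {eq_quot palg_eqv}.
HB.instance Definition _ : EqQuotient _ palg_eqv palg_car :=
  EqQuotient.on palg_car.
HB.instance Definition _ := Choice.on palg_car.

Definition palg_ev (B : nalgType K) (f : X -> B) (x : palg_car) : B :=
  neval f (repr x).

Lemma palg_evE (B : nalgType K) (f : X -> B) t :
  P f -> palg_ev f (\pi_palg_car t) = neval f t.
Proof.
move=> Pf; rewrite /palg_ev.
have /eqP : \pi_palg_car (repr (\pi_palg_car t)) = \pi_palg_car t by rewrite reprK.
by rewrite eqmodE => /asboolP; exact.
Qed.

Lemma palg_ext (x y : palg_car) :
  (forall (B : nalgType K) (f : X -> B), P f -> palg_ev f x = palg_ev f y) ->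
  x = y.
Proof.
move=> h; rewrite -[x]reprK -[y]reprK; apply/eqP; rewrite eqmodE.
by apply/asboolP => B f /h.
Qed.

Definition palg_zero : palg_car := \pi_palg_car NZero.
Definition palg_opp (x : palg_car) : palg_car := \pi_palg_car (NOpp (repr x)).
Definition palg_add (x y : palg_car) : palg_car := \pi_palg_car (NAdd (repr x) (repr y)).
Definition palg_scale (k : K) (x : palg_car) : palg_car :=
  \pi_palg_car (NScale k (repr x)).
Definition palg_mul (x y : palg_car) : palg_car := \pi_palg_car (NMul (repr x) (repr y)).

Section Ev.
Variables (B : nalgType K) (f : X -> B) (Pf : P f).
Lemma palg_ev0 : palg_ev f palg_zero = 0.
Proof. exact: palg_evE Pf. Qed.
Lemma palg_evN x : palg_ev f (palg_opp x) = - palg_ev f x.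
Proof. exact: palg_evE Pf. Qed.
Lemma palg_evD x y : palg_ev f (palg_add x y) = palg_ev f x + palg_ev f y.
Proof. exact: palg_evE Pf. Qed.
Lemma palg_evZ k x : palg_ev f (palg_scale k x) = k *: palg_ev f x.
Proof. exact: palg_evE Pf. Qed.
Lemma palg_evM x y : palg_ev f (palg_mul x y) = nmul (palg_ev f x) (palg_ev f y).
Proof. exact: palg_evE Pf. Qed.
Definition palg_evs := (palg_ev0, palg_evN, palg_evD, palg_evZ, palg_evM).
End Ev.

Lemma palg_addA : associative palg_add.
Proof. by move=> ? ? ?; apply: palg_ext => B f Pf; rewrite !(palg_evs Pf) addrA. Qed.
Lemma palg_addC : commutative palg_add.
Proof. by move=> ? ?; apply: palg_ext => B f Pf; rewrite !(palg_evs Pf) addrC. Qed.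
Lemma palg_add0 : left_id palg_zero palg_add.
Proof. by move=> ?; apply: palg_ext => B f Pf; rewrite !(palg_evs Pf) add0r. Qed.
Lemma palg_addN : left_inverse palg_zero palg_opp palg_add.
Proof. by move=> ?; apply: palg_ext => B f Pf; rewrite !(palg_evs Pf) addNr. Qed.
HB.instance Definition _ := GRing.isZmodule.Build palg_car
  palg_addA palg_addC palg_add0 palg_addN.

Lemma palg_scaleA a b x : palg_scale a (palg_scale b x) = palg_scale (a * b) x.
Proof. by apply: palg_ext => B f Pf; rewrite !(palg_evs Pf) scalerA. Qed.
Lemma palg_scale1 : left_id 1 palg_scale.
Proof. by move=> ?; apply: palg_ext => B f Pf; rewrite !(palg_evs Pf) scale1r. Qed.
Lemma palg_scaleDr : right_distributive palg_scale +%R.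
Proof.
move=> a x y; change (palg_scale a (palg_add x y) =
  palg_add (palg_scale a x) (palg_scale a y)).
by apply: palg_ext => B f Pf; rewrite !(palg_evs Pf) scalerDr.
Qed.
Lemma palg_scaleDl x : {morph palg_scale^~ x : a b / a + b}.
Proof.
move=> a b; change (palg_scale (a + b) x =
  palg_add (palg_scale a x) (palg_scale b x)).
by apply: palg_ext => B f Pf; rewrite !(palg_evs Pf) scalerDl.
Qed.
HB.instance Definition _ := GRing.Zmodule_isLmodule.Build K palg_car
  palg_scaleA palg_scale1 palg_scaleDr palg_scaleDl.

Lemma palg_mulA : associative palg_mul.
Proof. by move=> ? ? ?; apply: palg_ext => B f Pf; rewrite !(palg_evs Pf) nmulA. Qed.
Lemma palg_mul_linl y : linear (palg_mul^~ y).
Proof.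
move=> a x x'; change (palg_mul (palg_add (palg_scale a x) x') y =
  palg_add (palg_scale a (palg_mul x y)) (palg_mul x' y)).
by apply: palg_ext => B f Pf; rewrite !(palg_evs Pf) [LHS]nmul_linl.
Qed.
Lemma palg_mul_linr x : linear (palg_mul x).
Proof.
move=> a y y'; change (palg_mul x (palg_add (palg_scale a y) y') =
  palg_add (palg_scale a (palg_mul x y)) (palg_mul x y')).
by apply: palg_ext => B f Pf; rewrite !(palg_evs Pf) [LHS]nmul_linr.
Qed.
HB.instance Definition _ := Lmodule_isNAlgebra.Build K palg_car
  palg_mulA palg_mul_linl palg_mul_linr.

Definition palg : nalgType K := palg_car.
Definition palg_gen (x : X) : palg := \pi_palg_car (NGen K x).

Section Lift.
Variables (B : nalgType K) (f : X -> B) (Pf : P f).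

Lemma palg_lift_subproof : @is_nhom K palg B (palg_ev f).
Proof.
split=> [a x y|x y].
- change (palg_ev f (palg_add (palg_scale a x) y) = a *: palg_ev f x + palg_ev f y).
  by rewrite !(palg_evs Pf).
- change (palg_ev f (palg_mul x y) = nmul (palg_ev f x) (palg_ev f y)).
  by rewrite !(palg_evs Pf).
Qed.
Definition palg_lift : nhom palg B := nhom_of palg_lift_subproof.

Lemma palg_lift_gen x : palg_lift (palg_gen x) = f x.
Proof. exact: (palg_evE (NGen K x) Pf). Qed.
End Lift.

Lemma palg_piE (t : nterm K X) : \pi_palg_car t = neval palg_gen t.
Proof.
elim: t => //= [t <-|s <- t <-|k t <-|s <- t <-];
  by apply: palg_ext => B f Pf; rewrite !(palg_evs Pf, palg_evE _ Pf).
Qed.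

Lemma palg_ind (Q : palg -> Prop) :
  (forall x, Q (palg_gen x)) -> Q 0 -> (forall x, Q x -> Q (- x)) ->
  (forall x y, Q x -> Q y -> Q (x + y)) ->
  (forall k x, Q x -> Q (k *: x)) ->
  (forall x y, Q x -> Q y -> Q (nmul x y)) -> forall x, Q x.
Proof.
move=> h1 h2 h3 h4 h5 h6 x; rewrite -[x]reprK palg_piE.
by elim: (repr x) => //=; auto.
Qed.

Lemma palg_uniq (B : nalgType K) (g h : nhom palg B) :
  (forall x, g (palg_gen x) = h (palg_gen x)) -> g =1 h.
Proof.
move=> gh; apply: palg_ind => //.
- by rewrite !linear0.
- by move=> x e; rewrite !linearN e.
- by move=> x y e1 e2; rewrite !linearD e1 e2.
- by move=> k x e; rewrite !linearZ e.
- by move=> x y e1 e2; rewrite !nhomM e1 e2.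
Qed.

End Palg.

Section Tens.
Variables (K : fieldType) (V : lmodType K).

Definition tens_rel (B : nalgType K) (f : V -> B) : Prop := linear f.

(* [T(V)], given by its universal property [tens_lift], [tens_uniq] as the free
   non-unital associative algebra on the vector space [V]. *)
Definition tens : nalgType K := palg (@tens_rel).

Lemma tens_in_linear : linear (palg_gen (@tens_rel) : V -> tens).
Proof.
move=> k u v; apply: palg_ext => B f lf.
change (palg_ev f (palg_gen (@tens_rel) (k *: u + v)) =
  palg_lift lf (k *: palg_gen (@tens_rel) u + palg_gen (@tens_rel) v)).
rewrite linearP !palg_lift_gen; exact: etrans (palg_lift_gen lf _) (lf _ _ _).
Qed.
Definition tens_in : {linear V -> tens} := lin_of tens_in_linear.

Section Lift.
Variables (B : nalgType K) (f : {linear V -> B}).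
Definition tens_lift : nhom tens B := palg_lift (linearP f : tens_rel f).
Lemma tens_lift_in v : tens_lift (tens_in v) = f v.
Proof. exact: palg_lift_gen. Qed.
End Lift.

Lemma tens_uniq (B : nalgType K) (g h : nhom tens B) :
  (forall v, g (tens_in v) = h (tens_in v)) -> g =1 h.
Proof. exact: palg_uniq. Qed.
End Tens.

Section FProd.
Variables (K : fieldType) (I : Type) (A : I -> nalgType K).

Definition fprod_rel (B : nalgType K) (f : {i & A i} -> B) : Prop :=
  forall i, is_nhom (fun a : A i => f (existT _ i a)).

(* The coproduct of the non-unital algebras [A i] ([fprod_lift],
   [fprod_uniq]). *)
Definition fprod : nalgType K := palg (@fprod_rel).

Let gen i (a : A i) : fprod := palg_gen (@fprod_rel) (existT _ i a).

Lemma fprod_in_subproof i : is_nhom (@gen i).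
Proof.
split=> [k a b|a b]; apply: palg_ext => B f hf.
- change (palg_lift hf (gen (k *: a + b)) = palg_lift hf (k *: gen a + gen b)).
  by rewrite linearP !palg_lift_gen (hf i).1.
- change (palg_lift hf (gen (nmul a b)) = palg_lift hf (nmul (gen a) (gen b))).
  by rewrite nhomM !palg_lift_gen (hf i).2.
Qed.
Definition fprod_in i : nhom (A i) fprod := nhom_of (@fprod_in_subproof i).

Section Lift.
Variables (B : nalgType K) (f : forall i, nhom (A i) B).

Lemma fprod_lift_subproof :
  fprod_rel (fun x : {i & A i} => f (projT1 x) (projT2 x)).
Proof. by move=> i; exact: (is_nhomP (f i)). Qed.
Definition fprod_lift : nhom fprod B := palg_lift fprod_lift_subproof.

Lemma fprod_lift_in i a : fprod_lift (fprod_in i a) = f i a.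
Proof. exact: (palg_lift_gen fprod_lift_subproof (existT _ i a)). Qed.
End Lift.

Lemma fprod_uniq (B : nalgType K) (g h : nhom fprod B) :
  (forall i a, g (fprod_in i a) = h (fprod_in i a)) -> g =1 h.
Proof. by move=> gh; apply: palg_uniq => -[i a]; exact: gh. Qed.

Lemma fprod_ind (Q : fprod -> Prop) :
  (forall i a, Q (fprod_in i a)) -> Q 0 ->
  (forall k x y, Q x -> Q y -> Q (k *: x + y)) ->
  (forall x y, Q x -> Q y -> Q (nmul x y)) -> forall x, Q x.
Proof.
move=> h1 h0 h2 h3; apply: palg_ind => //.
- by move=> [i a]; exact: h1.
- by move=> x Qx; rewrite -scaleN1r -[_ *: _]addr0; exact: h2.
- by move=> x y Qx Qy; rewrite -[x]scale1r; exact: h2.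
- by move=> k x Qx; rewrite -[_ *: _]addr0; exact: h2.
Qed.
End FProd.

Section FProd2.
Variables (K : fieldType).

Definition fp2 (A1 A2 : nalgType K) : nalgType K :=
  fprod (fun b : bool => if b then A2 else A1).
Definition fp2_in1 (A1 A2 : nalgType K) : nhom A1 (fp2 A1 A2) :=
  fprod_in (fun b : bool => if b then A2 else A1) false.
Definition fp2_in2 (A1 A2 : nalgType K) : nhom A2 (fp2 A1 A2) :=
  fprod_in (fun b : bool => if b then A2 else A1) true.
Definition fp2_lift (A1 A2 B : nalgType K) (f1 : nhom A1 B) (f2 : nhom A2 B) :
    nhom (fp2 A1 A2) B :=
  fprod_lift (fun b : bool =>
    if b return nhom (if b then A2 else A1) B then f2 else f1).

Lemma fp2_lift_in1 (A1 A2 B : nalgType K) (f1 : nhom A1 B) (f2 : nhom A2 B) a :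
  fp2_lift f1 f2 (fp2_in1 A1 A2 a) = f1 a.
Proof. exact: (fprod_lift_in _ (i := false)). Qed.
Lemma fp2_lift_in2 (A1 A2 B : nalgType K) (f1 : nhom A1 B) (f2 : nhom A2 B) a :
  fp2_lift f1 f2 (fp2_in2 A1 A2 a) = f2 a.
Proof. exact: (fprod_lift_in _ (i := true)). Qed.

Lemma fp2_uniq (A1 A2 B : nalgType K) (g h : nhom (fp2 A1 A2) B) :
  (forall a, g (fp2_in1 A1 A2 a) = h (fp2_in1 A1 A2 a)) ->
  (forall a, g (fp2_in2 A1 A2 a) = h (fp2_in2 A1 A2 a)) -> g =1 h.
Proof. by move=> h1 h2; apply: fprod_uniq => -[]. Qed.

Definition fp2_map (A1 A2 B1 B2 : nalgType K) (j1 : nhom B1 A1)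
    (j2 : nhom B2 A2) : nhom (fp2 B1 B2) (fp2 A1 A2) :=
  fp2_lift (nhom_comp (fp2_in1 A1 A2) j1) (nhom_comp (fp2_in2 A1 A2) j2).

Definition fp2_swap (A1 A2 : nalgType K) : nhom (fp2 A1 A2) (fp2 A2 A1) :=
  fp2_lift (fp2_in2 A2 A1) (fp2_in1 A2 A1).

Definition fp2_assoc (A1 A2 A3 : nalgType K) :
    nhom (fp2 (fp2 A1 A2) A3) (fp2 A1 (fp2 A2 A3)) :=
  fp2_lift
    (fp2_lift (fp2_in1 A1 (fp2 A2 A3))
              (nhom_comp (fp2_in2 A1 (fp2 A2 A3)) (fp2_in1 A2 A3)))
    (nhom_comp (fp2_in2 A1 (fp2 A2 A3)) (fp2_in2 A2 A3)).
End FProd2.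

Section Subalg.
Variables (K : fieldType).

Record subalg (A : nalgType K) := Subalg {
  subalg_set : set A;
  subalg0 : subalg_set 0;
  subalgP : forall k x y, subalg_set x -> subalg_set y -> subalg_set (k *: x + y);
  subalgM : forall x y, subalg_set x -> subalg_set y -> subalg_set (nmul x y)
}.

Section Carrier.
Variables (A : nalgType K) (S : subalg A).

Definition subalg_pred : {pred A} := fun x => `[< subalg_set S x >].
Definition subalg_car := {x : A | subalg_pred x}.
HB.instance Definition _ := [isSub of subalg_car for @sval _ _].
HB.instance Definition _ := [Choice of subalg_car by <:].

Lemma subalg_closed_subproof : GRing.subsemimod_closed subalg_pred.
Proof.
split; first split.
- by apply/asboolP; exact: subalg0.
- move=> x y /asboolP Sx /asboolP Sy; apply/asboolP.
  by rewrite -[x]scale1r; exact: subalgP.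
- move=> k x /asboolP Sx; apply/asboolP; rewrite -[_ *: _]addr0.
  by apply: subalgP => //; exact: subalg0.
Qed.
HB.instance Definition _ := GRing.SubChoice_isSubLmodule.Build K A subalg_pred
  subalg_car subalg_closed_subproof.

Lemma subalg_mul_subproof (x y : subalg_car) :
  subalg_pred (nmul (\val x) (\val y)).
Proof.
by apply/asboolP/subalgM; apply/asboolP; [exact: (valP x)|exact: (valP y)].
Qed.
Definition subalg_mul (x y : subalg_car) : subalg_car :=
  Sub (nmul (\val x) (\val y)) (subalg_mul_subproof x y).

Lemma subalg_mulA : associative subalg_mul.
Proof. by move=> x y z; apply: val_inj; rewrite !SubK nmulA. Qed.
Lemma subalg_mul_linl y : linear (subalg_mul^~ y).
Proof.
move=> k x x'; apply: val_inj; rewrite !(SubK, linearP) /=.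
exact: nmul_linl.
Qed.
Lemma subalg_mul_linr x : linear (subalg_mul x).
Proof.
move=> k y y'; apply: val_inj; rewrite !(SubK, linearP) /=.
exact: nmul_linr.
Qed.
HB.instance Definition _ := Lmodule_isNAlgebra.Build K subalg_car
  subalg_mulA subalg_mul_linl subalg_mul_linr.

Definition subalg_alg : nalgType K := subalg_car.

Lemma subalg_incl_subproof : @is_nhom K subalg_alg A (fun x => \val x).
Proof. by split=> [k x y|x y] //; rewrite linearP. Qed.
Definition subalg_incl : nhom subalg_alg A := nhom_of subalg_incl_subproof.
End Carrier.

Section Image.
Variables (A B : nalgType K) (f : nhom A B).
Lemma subalg_im0 : range f 0.
Proof. by exists 0 => //; exact: linear0. Qed.
Lemma subalg_imP k x y : range f x -> range f y -> range f (k *: x + y).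
Proof. by move=> [a _ <-] [b _ <-]; exists (k *: a + b) => //; exact: linearP. Qed.
Lemma subalg_imM x y : range f x -> range f y -> range f (nmul x y).
Proof. by move=> [a _ <-] [b _ <-]; exists (nmul a b) => //; exact: nhomM. Qed.
Definition subalg_im : subalg B := Subalg subalg_im0 subalg_imP subalg_imM.
End Image.
End Subalg.

Section AlgP.
Variables (K : fieldType) (m : nat).

Definition free_map (A : nalgType K) (S : 'I_m -> subalg A) :
    nhom (fprod (fun l => subalg_alg (S l))) A :=
  fprod_lift (fun l => subalg_incl (S l)).

Record algP := AlgP {
  algP_alg :> nalgType K;
  algP_sub : 'I_m -> subalg algP_alg;
  algP_free : bijective (free_map algP_sub)
}.

Definition algP_mor (B A : algP) (j : nhom B A) : Prop :=
  forall l x, subalg_set (algP_sub B l) x -> subalg_set (algP_sub A l) (j x).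

Lemma nhom_inv_ex (A B : nalgType K) (f : nhom A B) :
  bijective f -> exists g : nhom B A, cancel f g /\ cancel g f.
Proof.
move=> [g fK gK].
have hg : is_nhom g.
  split=> [k x y|x y]; apply: (can_inj fK).
  - by rewrite linearP !gK.
  - by rewrite nhomM !gK.
by exists (nhom_of hg).
Qed.

Section Corestr.
Variables (C B : nalgType K) (f : nhom C B) (S : subalg B).
Hypothesis fS : forall x, subalg_set S (f x).
Definition corestr_fun (x : C) : subalg_alg S := Sub (f x) (asboolT (fS x)).
Lemma corestr_subproof : is_nhom corestr_fun.
Proof.
split=> [k x y|x y]; apply: val_inj; first by rewrite !(SubK, linearP).
by rewrite SubK nhomM.
Qed.
Definition corestr : nhom C (subalg_alg S) := nhom_of corestr_subproof.
Lemma corestrK x : \val (corestr x) = f x. Proof. by []. Qed.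
End Corestr.

Lemma im_inP (A B : nalgType K) (f : nhom A B) x :
  subalg_set (subalg_im f) (f x).
Proof. by exists x. Qed.

Lemma subalg_carP (A : nalgType K) (S : subalg A) (s : subalg_alg S) :
  subalg_set S (\val s).
Proof. by apply/asboolP; exact: (valP s). Qed.

Lemma free_mapE (A : nalgType K) (S : 'I_m -> subalg A) l (s : subalg_alg (S l)) :
  free_map S (fprod_in (fun l => subalg_alg (S l)) l s) = \val s.
Proof. exact: fprod_lift_in. Qed.

Lemma free_crit (A : nalgType K) (S : 'I_m -> subalg A)
    (r : nhom A (fprod (fun l => subalg_alg (S l)))) :
  (forall l (s : subalg_alg (S l)),
     r (\val s) = fprod_in (fun l => subalg_alg (S l)) l s) ->
  (forall x, free_map S (r x) = x) -> bijective (free_map S).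
Proof.
move=> h1 h2; exists r => //.
have := @fprod_uniq _ _ _ _ (nhom_comp r (free_map S)) (nhom_id _).
apply=> l s.
exact: etrans (congr1 r (free_mapE s)) (h1 l s).
Qed.

Section FP2.
Variables A1 A2 : algP.

(* [A1^(l) |_| A2^(l)], as the image of the canonical map to [A1 |_| A2]. *)
Definition fp2_sub (l : 'I_m) : subalg (fp2 A1 A2) :=
  subalg_im (fp2_map (subalg_incl (algP_sub A1 l)) (subalg_incl (algP_sub A2 l))).

Lemma fp2_free : bijective (free_map fp2_sub).
Proof.
have [g1 [fK1 gK1]] := nhom_inv_ex (algP_free A1).
have [g2 [fK2 gK2]] := nhom_inv_ex (algP_free A2).
pose i1 l := subalg_incl (algP_sub A1 l).
pose i2 l := subalg_incl (algP_sub A2 l).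
pose q l := corestr (im_inP (fp2_map (i1 l) (i2 l))) : nhom _ (subalg_alg (fp2_sub l)).
pose inn l := fprod_in (fun l => subalg_alg (fp2_sub l)) l.
pose r1 := fprod_lift (fun l => nhom_comp (inn l) (nhom_comp (q l) (fp2_in1 _ _))).
pose r2 := fprod_lift (fun l => nhom_comp (inn l) (nhom_comp (q l) (fp2_in2 _ _))).
pose r := fp2_lift (nhom_comp r1 g1) (nhom_comp r2 g2).
apply: (@free_crit _ _ r) => [l s|].
  have [c _ cs] := subalg_carP s.
  have -> : s = q l c by apply: val_inj; rewrite corestrK.
  rewrite corestrK.
  have := @fp2_uniq _ _ _ _ (nhom_comp r (fp2_map (i1 l) (i2 l)))
            (nhom_comp (inn l) (q l)).
  apply=> {c s cs} a.
  - rewrite !nhom_compE fp2_lift_in1 !nhom_compE fp2_lift_in1 nhom_compE.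
    have -> : i1 l a = free_map (algP_sub A1) (fprod_in _ l a)
      by rewrite free_mapE.
    by rewrite fK1 fprod_lift_in.
  - rewrite !nhom_compE fp2_lift_in2 !nhom_compE fp2_lift_in2 nhom_compE.
    have -> : i2 l a = free_map (algP_sub A2) (fprod_in _ l a)
      by rewrite free_mapE.
    by rewrite fK2 fprod_lift_in.
have := @fp2_uniq _ _ _ _ (nhom_comp (free_map fp2_sub) r) (nhom_id _).
apply=> a.
- rewrite nhom_compE fp2_lift_in1 nhom_compE -[in RHS](gK1 a).
  have := @fprod_uniq _ _ _ _ (nhom_comp (free_map fp2_sub) r1)
    (nhom_comp (fp2_in1 _ _) (free_map (algP_sub A1))).
  apply=> l s; rewrite !nhom_compE [in RHS]free_mapE /r1 fprod_lift_in.
  rewrite !nhom_compE free_mapE corestrK; exact: fp2_lift_in1.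
- rewrite nhom_compE fp2_lift_in2 nhom_compE -[in RHS](gK2 a).
  have := @fprod_uniq _ _ _ _ (nhom_comp (free_map fp2_sub) r2)
    (nhom_comp (fp2_in2 _ _) (free_map (algP_sub A2))).
  apply=> l s; rewrite !nhom_compE [in RHS]free_mapE /r2 fprod_lift_in.
  rewrite !nhom_compE free_mapE corestrK; exact: fp2_lift_in2.
Qed.

Definition algP_fp2 : algP := AlgP fp2_free.
End FP2.

Section Copies.
Variable B : 'I_m -> nalgType K.

Definition fprod_sub (l : 'I_m) : subalg (fprod B) := subalg_im (fprod_in B l).

Lemma fprod_free : bijective (free_map fprod_sub).
Proof.
pose q l := corestr (im_inP (fprod_in B l)) : nhom _ (subalg_alg (fprod_sub l)).
pose inn l := fprod_in (fun l => subalg_alg (fprod_sub l)) l.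
pose r := fprod_lift (fun l => nhom_comp (inn l) (q l)).
apply: (@free_crit _ _ r) => [l s|].
  have [c _ cs] := subalg_carP s.
  have -> : s = q l c by apply: val_inj; rewrite corestrK.
  by rewrite corestrK fprod_lift_in.
have := @fprod_uniq _ _ _ _ (nhom_comp (free_map fprod_sub) r) (nhom_id _).
by apply=> l a; rewrite nhom_compE fprod_lift_in nhom_compE free_mapE.
Qed.

Definition algP_fprod : algP := AlgP fprod_free.
End Copies.
End AlgP.

Inductive sterm (K W : Type) : Type :=
| SGen of W
| SZero
| SOne
| SOpp of sterm K W
| SAdd of sterm K W & sterm K W
| SScale of K & sterm K W
| SMul of sterm K W & sterm K W.
Arguments SGen K {W}.
Arguments SZero K {W}.
Arguments SOne K {W}.

HB.instance Definition _ (K W : Type) := gen_eqMixin (sterm K W).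
HB.instance Definition _ (K W : Type) := gen_choiceMixin (sterm K W).

Fixpoint seval (K : fieldType) (W : Type) (B : comAlgType K) (f : W -> B)
    (t : sterm K W) : B :=
  match t with
  | SGen x => f x
  | SZero => 0
  | SOne => 1
  | SOpp t => - seval f t
  | SAdd s t => seval f s + seval f t
  | SScale k t => k *: seval f t
  | SMul s t => seval f s * seval f t
  end.

Section Sym.
Variables (K : fieldType) (W : lmodType K).

(* Two terms are identified when they take the same value in every commutative
   unital algebra [B] for every linear [W -> B]. *)
Definition sym_eqv : rel (sterm K W) := fun s t =>
  `[< forall (B : comAlgType K) (f : {linear W -> B}), seval f s = seval f t >].

Lemma sym_eqv_refl : reflexive sym_eqv.
Proof. by move=> s; apply/asboolP. Qed.
Lemma sym_eqv_sym : symmetric sym_eqv.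
Proof. by move=> s t; apply/asboolP/asboolP => h B f; rewrite h. Qed.
Lemma sym_eqv_trans : transitive sym_eqv.
Proof.
by move=> t s u /asboolP h1 /asboolP h2; apply/asboolP => B f; rewrite h1 ?h2.
Qed.
Canonical sym_equiv := EquivRel sym_eqv sym_eqv_refl sym_eqv_sym sym_eqv_trans.

Definition sym := {eq_quot sym_eqv}.
HB.instance Definition _ : EqQuotient _ sym_eqv sym := EqQuotient.on sym.
HB.instance Definition _ := Choice.on sym.

Definition sym_ev (B : comAlgType K) (f : {linear W -> B}) (x : sym) : B :=
  seval f (repr x).

Lemma sym_evE (B : comAlgType K) (f : {linear W -> B}) t :
  sym_ev f (\pi_sym t) = seval f t.
Proof.
rewrite /sym_ev.
have /eqP : \pi_sym (repr (\pi_sym t)) = \pi_sym t by rewrite reprK.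
by rewrite eqmodE => /asboolP; exact.
Qed.

Lemma sym_ext (x y : sym) :
  (forall (B : comAlgType K) (f : {linear W -> B}), sym_ev f x = sym_ev f y) ->
  x = y.
Proof.
move=> h; rewrite -[x]reprK -[y]reprK; apply/eqP; rewrite eqmodE.
by apply/asboolP => B f; exact: h.
Qed.

Definition sym_zero : sym := \pi_sym (SZero K).
Definition sym_one : sym := \pi_sym (SOne K).
Definition sym_opp (x : sym) : sym := \pi_sym (SOpp (repr x)).
Definition sym_add (x y : sym) : sym := \pi_sym (SAdd (repr x) (repr y)).
Definition sym_scale (k : K) (x : sym) : sym := \pi_sym (SScale k (repr x)).
Definition sym_mul (x y : sym) : sym := \pi_sym (SMul (repr x) (repr y)).

Section Ev.
Variables (B : comAlgType K) (f : {linear W -> B}).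
Lemma sym_ev0 : sym_ev f sym_zero = 0. Proof. exact: sym_evE. Qed.
Lemma sym_ev1 : sym_ev f sym_one = 1. Proof. exact: sym_evE. Qed.
Lemma sym_evN x : sym_ev f (sym_opp x) = - sym_ev f x.
Proof. exact: sym_evE. Qed.
Lemma sym_evD x y : sym_ev f (sym_add x y) = sym_ev f x + sym_ev f y.
Proof. exact: sym_evE. Qed.
Lemma sym_evZ k x : sym_ev f (sym_scale k x) = k *: sym_ev f x.
Proof. exact: sym_evE. Qed.
Lemma sym_evM x y : sym_ev f (sym_mul x y) = sym_ev f x * sym_ev f y.
Proof. exact: sym_evE. Qed.
Definition sym_evs := (sym_ev0, sym_ev1, sym_evN, sym_evD, sym_evZ, sym_evM).
End Ev.

Lemma sym_addA : associative sym_add.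
Proof. by move=> ? ? ?; apply: sym_ext => B f; rewrite !sym_evs addrA. Qed.
Lemma sym_addC : commutative sym_add.
Proof. by move=> ? ?; apply: sym_ext => B f; rewrite !sym_evs addrC. Qed.
Lemma sym_add0 : left_id sym_zero sym_add.
Proof. by move=> ?; apply: sym_ext => B f; rewrite !sym_evs add0r. Qed.
Lemma sym_addN : left_inverse sym_zero sym_opp sym_add.
Proof. by move=> ?; apply: sym_ext => B f; rewrite !sym_evs addNr. Qed.
HB.instance Definition _ := GRing.isZmodule.Build sym
  sym_addA sym_addC sym_add0 sym_addN.

Lemma sym_mulA : associative sym_mul.
Proof. by move=> ? ? ?; apply: sym_ext => B f; rewrite !sym_evs mulrA. Qed.
Lemma sym_mulC : commutative sym_mul.
Proof. by move=> ? ?; apply: sym_ext => B f; rewrite !sym_evs mulrC. Qed.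
Lemma sym_mul1 : left_id sym_one sym_mul.
Proof. by move=> ?; apply: sym_ext => B f; rewrite !sym_evs mul1r. Qed.
Lemma sym_mulDl : left_distributive sym_mul +%R.
Proof.
move=> x y z; change (sym_mul (sym_add x y) z =
  sym_add (sym_mul x z) (sym_mul y z)).
by apply: sym_ext => B f; rewrite !sym_evs mulrDl.
Qed.
Lemma sym_1neq0 : sym_one != 0.
Proof.
apply/eqP => /(congr1 (sym_ev (\0 : {linear W -> K^o}))).
rewrite (_ : 0 = sym_zero) // sym_ev1 sym_ev0 => /eqP.
by rewrite oner_eq0.
Qed.
HB.instance Definition _ := GRing.Zmodule_isComNzRing.Build sym
  sym_mulA sym_mulC sym_mul1 sym_mulDl sym_1neq0.

Lemma sym_scaleA a b x : sym_scale a (sym_scale b x) = sym_scale (a * b) x.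
Proof. by apply: sym_ext => B f; rewrite !sym_evs scalerA. Qed.
Lemma sym_scale1 : left_id 1 sym_scale.
Proof. by move=> ?; apply: sym_ext => B f; rewrite !sym_evs scale1r. Qed.
Lemma sym_scaleDr : right_distributive sym_scale +%R.
Proof.
move=> a x y; change (sym_scale a (sym_add x y) =
  sym_add (sym_scale a x) (sym_scale a y)).
by apply: sym_ext => B f; rewrite !sym_evs scalerDr.
Qed.
Lemma sym_scaleDl x : {morph sym_scale^~ x : a b / a + b}.
Proof.
move=> a b; change (sym_scale (a + b) x =
  sym_add (sym_scale a x) (sym_scale b x)).
by apply: sym_ext => B f; rewrite !sym_evs scalerDl.
Qed.
HB.instance Definition _ := GRing.Zmodule_isLmodule.Build K sym
  sym_scaleA sym_scale1 sym_scaleDr sym_scaleDl.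

Lemma sym_scaleAl k (x y : sym) : k *: (x * y) = (k *: x) * y.
Proof.
change (sym_scale k (sym_mul x y) = sym_mul (sym_scale k x) y).
by apply: sym_ext => B f; rewrite !sym_evs scalerAl.
Qed.
HB.instance Definition _ := GRing.Lmodule_isLalgebra.Build K sym sym_scaleAl.
HB.instance Definition _ := GRing.Lalgebra_isComAlgebra.Build K sym.

Let gen (w : W) : sym := \pi_sym (SGen K w).
Lemma sym_in_linear : linear gen.
Proof.
move=> k u v; change (gen (k *: u + v) = sym_add (sym_scale k (gen u)) (gen v)).
by apply: sym_ext => B f; rewrite !sym_evs !sym_evE /= linearP.
Qed.
Definition sym_in : {linear W -> sym} := lin_of sym_in_linear.

Section Lift.
Variables (B : comAlgType K) (f : {linear W -> B}).

Lemma sym_lift_linear : linear (sym_ev f).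
Proof.
move=> k x y; change (sym_ev f (sym_add (sym_scale k x) y) =
  k *: sym_ev f x + sym_ev f y).
by rewrite !sym_evs.
Qed.
Lemma sym_lift_mult : monoid_morphism (sym_ev f).
Proof. by split=> [|x y]; [exact: sym_ev1 | exact: sym_evM]. Qed.
Definition sym_lift : {lrmorphism sym -> B} :=
  HB.pack (sym_ev f) (GRing.isLinear.Build K sym B *:%R (sym_ev f) sym_lift_linear)
    (GRing.isMonoidMorphism.Build sym B (sym_ev f) sym_lift_mult).

Lemma sym_lift_in w : sym_lift (sym_in w) = f w.
Proof. exact: sym_evE. Qed.
End Lift.

Lemma sym_piE (t : sterm K W) : \pi_sym t = seval sym_in t.
Proof.
elim: t => //= [t <-|s <- t <-|k t <-|s <- t <-];
  by apply: sym_ext => B f; rewrite !(sym_evs, sym_evE).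
Qed.

Lemma sym_ind (Q : sym -> Prop) :
  Q 1 -> (forall w x, Q x -> Q (sym_in w * x)) ->
  (forall k x y, Q x -> Q y -> Q (k *: x + y)) -> forall x, Q x.
Proof.
move=> h1 hM hP.
have h0 : Q 0 by rewrite -[0](addNr 1) -scaleN1r; exact: hP.
suff h t x : Q x -> Q (seval sym_in t * x).
  by move=> x; rewrite -[x]reprK sym_piE -[seval _ _]mulr1; exact: h.
elim: t x => /= [w|||t IH|s IHs t IHt|k t IH|s IHs t IHt] x Qx.
- exact: hM.
- by rewrite mul0r.
- by rewrite mul1r.
- by rewrite mulNr -scaleN1r -[_ *: _]addr0; apply: hP => //; exact: IH.
- by rewrite mulrDl -[seval _ s * x]scale1r; apply: hP; [exact: IHs|exact: IHt].
- by rewrite -scalerAl -[_ *: _]addr0; apply: hP => //; exact: IH.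
- by rewrite -mulrA; apply: IHs; exact: IHt.
Qed.

Lemma sym_uniq (B : comAlgType K) (g h : {lrmorphism sym -> B}) :
  (forall w, g (sym_in w) = h (sym_in w)) -> g =1 h.
Proof.
move=> gh; apply: sym_ind; first by rewrite !rmorph1.
- move=> w x e; apply: (etrans (rmorphM g _ _)).
  by apply: (etrans _ (esym (rmorphM h _ _))); congr (_ * _);
    [exact: gh | exact: e].
- move=> k x y e1 e2; apply: (etrans (linearP g _ _ _)).
  by apply: (etrans _ (esym (linearP h _ _ _))); congr (_ *: _ + _);
    [exact: e1 | exact: e2].
Qed.
End Sym.

Definition bilin (K : fieldType) (U V W : lmodType K) (f : U -> V -> W) : Prop :=
  (forall v, linear (f^~ v)) /\ (forall u, linear (f u)).

Definition bsum (K : fieldType) (U V W : lmodType K) (f : U -> V -> W)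
    (s : seq (U * V)) : W := \sum_(p <- s) f p.1 p.2.

Section TProd.
Variables (K : fieldType) (U V : lmodType K).

(* A list of pairs stands for the sum of the corresponding pure tensors; two
   lists are identified when every bilinear map into every vector space takes
   the same value on them. *)
Definition tprod_eqv : rel (seq (U * V)) := fun s t =>
  `[< forall (W : lmodType K) (f : U -> V -> W), bilin f ->
        bsum f s = bsum f t >].

Lemma tprod_eqv_refl : reflexive tprod_eqv.
Proof. by move=> s; apply/asboolP. Qed.
Lemma tprod_eqv_sym : symmetric tprod_eqv.
Proof. by move=> s t; apply/asboolP/asboolP => h W f bf; rewrite h. Qed.
Lemma tprod_eqv_trans : transitive tprod_eqv.
Proof.
by move=> t s u /asboolP h1 /asboolP h2; apply/asboolP => W f bf; rewrite h1 ?h2.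
Qed.
Canonical tprod_equiv :=
  EquivRel tprod_eqv tprod_eqv_refl tprod_eqv_sym tprod_eqv_trans.

Definition tprod := {eq_quot tprod_eqv}.
HB.instance Definition _ : EqQuotient _ tprod_eqv tprod := EqQuotient.on tprod.
HB.instance Definition _ := Choice.on tprod.

Definition tprod_ev (W : lmodType K) (f : U -> V -> W) (x : tprod) : W :=
  bsum f (repr x).

Lemma tprod_evE (W : lmodType K) (f : U -> V -> W) s :
  bilin f -> tprod_ev f (\pi_tprod s) = bsum f s.
Proof.
move=> bf; rewrite /tprod_ev.
have /eqP : \pi_tprod (repr (\pi_tprod s)) = \pi_tprod s by rewrite reprK.
by rewrite eqmodE => /asboolP; exact.
Qed.

Lemma tprod_ext (x y : tprod) :
  (forall (W : lmodType K) (f : U -> V -> W), bilin f ->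
     tprod_ev f x = tprod_ev f y) -> x = y.
Proof.
move=> h; rewrite -[x]reprK -[y]reprK; apply/eqP; rewrite eqmodE.
by apply/asboolP => W f; exact: h.
Qed.

Definition tprod_zero : tprod := \pi_tprod [::].
Definition tprod_scale (k : K) (x : tprod) : tprod :=
  \pi_tprod [seq (k *: p.1, p.2) | p <- repr x].
Definition tprod_opp (x : tprod) : tprod := tprod_scale (-1) x.
Definition tprod_add (x y : tprod) : tprod := \pi_tprod (repr x ++ repr y).

Section Ev.
Variables (W : lmodType K) (f : U -> V -> W) (bf : bilin f).
Lemma tprod_ev0 : tprod_ev f tprod_zero = 0.
Proof. by rewrite tprod_evE // /bsum big_nil. Qed.
Lemma tprod_evZ k x : tprod_ev f (tprod_scale k x) = k *: tprod_ev f x.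
Proof.
rewrite tprod_evE // /tprod_ev /bsum big_map scaler_sumr.
by apply: eq_bigr => p _; exact: (linearZZ (lin_of (bf.1 p.2))).
Qed.
Lemma tprod_evN x : tprod_ev f (tprod_opp x) = - tprod_ev f x.
Proof. by rewrite tprod_evZ scaleN1r. Qed.
Lemma tprod_evD x y : tprod_ev f (tprod_add x y) = tprod_ev f x + tprod_ev f y.
Proof. by rewrite tprod_evE // /bsum big_cat. Qed.
Definition tprod_evs := (tprod_ev0, tprod_evN, tprod_evD, tprod_evZ).
End Ev.

Lemma tprod_addA : associative tprod_add.
Proof.
by move=> ? ? ?; apply: tprod_ext => W f bf; rewrite !(tprod_evs bf) addrA.
Qed.
Lemma tprod_addC : commutative tprod_add.
Proof.
by move=> ? ?; apply: tprod_ext => W f bf; rewrite !(tprod_evs bf) addrC.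
Qed.
Lemma tprod_add0 : left_id tprod_zero tprod_add.
Proof.
by move=> ?; apply: tprod_ext => W f bf; rewrite !(tprod_evs bf) add0r.
Qed.
Lemma tprod_addN : left_inverse tprod_zero tprod_opp tprod_add.
Proof.
by move=> ?; apply: tprod_ext => W f bf; rewrite !(tprod_evs bf) addNr.
Qed.
HB.instance Definition _ := GRing.isZmodule.Build tprod
  tprod_addA tprod_addC tprod_add0 tprod_addN.

Lemma tprod_scaleA a b x :
  tprod_scale a (tprod_scale b x) = tprod_scale (a * b) x.
Proof. by apply: tprod_ext => W f bf; rewrite !(tprod_evs bf) scalerA. Qed.
Lemma tprod_scale1 : left_id 1 tprod_scale.
Proof.
by move=> ?; apply: tprod_ext => W f bf; rewrite !(tprod_evs bf) scale1r.
Qed.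
Lemma tprod_scaleDr : right_distributive tprod_scale +%R.
Proof.
move=> a x y; change (tprod_scale a (tprod_add x y) =
  tprod_add (tprod_scale a x) (tprod_scale a y)).
by apply: tprod_ext => W f bf; rewrite !(tprod_evs bf) scalerDr.
Qed.
Lemma tprod_scaleDl x : {morph tprod_scale^~ x : a b / a + b}.
Proof.
move=> a b; change (tprod_scale (a + b) x =
  tprod_add (tprod_scale a x) (tprod_scale b x)).
by apply: tprod_ext => W f bf; rewrite !(tprod_evs bf) scalerDl.
Qed.
HB.instance Definition _ := GRing.Zmodule_isLmodule.Build K tprod
  tprod_scaleA tprod_scale1 tprod_scaleDr tprod_scaleDl.

Definition pure (u : U) (v : V) : tprod := \pi_tprod [:: (u, v)].

Lemma tprod_ev_pure (W : lmodType K) (f : U -> V -> W) u v :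
  bilin f -> tprod_ev f (pure u v) = f u v.
Proof. by move=> bf; rewrite tprod_evE // /bsum big_seq1. Qed.

Lemma pure_bilin : bilin pure.
Proof.
split=> [v k u u'|u k v v'].
- change (pure (k *: u + u') v = tprod_add (tprod_scale k (pure u v)) (pure u' v)).
  by apply: tprod_ext => W f bf; rewrite !(tprod_evs bf) !tprod_ev_pure // bf.1.
- change (pure u (k *: v + v') = tprod_add (tprod_scale k (pure u v)) (pure u v')).
  by apply: tprod_ext => W f bf; rewrite !(tprod_evs bf) !tprod_ev_pure // bf.2.
Qed.

Section Lift.
Variables (W : lmodType K) (f : U -> V -> W) (bf : bilin f).
Lemma tprod_lift_linear : linear (tprod_ev f).
Proof.
move=> k x y; change (tprod_ev f (tprod_add (tprod_scale k x) y) =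
  k *: tprod_ev f x + tprod_ev f y).
by rewrite !(tprod_evs bf).
Qed.
Definition tprod_lift : {linear tprod -> W} := lin_of tprod_lift_linear.
Lemma tprod_lift_pure u v : tprod_lift (pure u v) = f u v.
Proof. exact: tprod_ev_pure. Qed.
End Lift.

Lemma tprod_piE (s : seq (U * V)) :
  \pi_tprod s = \sum_(p <- s) pure p.1 p.2.
Proof.
elim: s => [|[u v] s IH]; first by rewrite big_nil.
rewrite big_cons -IH.
change (\pi_tprod ((u, v) :: s) = tprod_add (pure u v) (\pi_tprod s)).
apply: tprod_ext => W f bf; rewrite !(tprod_evs bf) tprod_ev_pure //.
by rewrite !tprod_evE // /bsum big_cons.
Qed.

Lemma tprod_ind (Q : tprod -> Prop) :
  Q 0 -> (forall u v x, Q x -> Q (pure u v + x)) -> forall x, Q x.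
Proof.
move=> h0 h x; rewrite -[x]reprK tprod_piE.
by elim: (repr x) => [|p s IH]; rewrite ?big_nil ?big_cons //; exact: h.
Qed.

Lemma tprod_uniq (W : lmodType K) (g h : {linear tprod -> W}) :
  (forall u v, g (pure u v) = h (pure u v)) -> g =1 h.
Proof.
move=> gh; apply: tprod_ind => [|u v x e]; first by rewrite !linear0.
by rewrite !linearD gh e.
Qed.
End TProd.

Section SymTProd.
Variables (K : fieldType) (W1 W2 : lmodType K).
Notation A := (sym W1).
Notation B := (sym W2).
Notation T := (tprod A B).

Definition tmul (x y : T) : T :=
  \pi_T [seq (p.1 * q.1, p.2 * q.2) | p <- repr x, q <- repr y].
Definition tone : T := pure 1 1.

Lemma bilin_mull (W : lmodType K) (f : A -> B -> W) (y : T) : bilin f ->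
  bilin (fun a b => tprod_ev (fun a' b' => f (a * a') (b * b')) y).
Proof.
move=> bf; split=> [b k a a'|a k b b']; rewrite /tprod_ev /bsum scaler_sumr
  -big_split; apply: eq_bigr => q _ /=.
- by rewrite mulrDl -scalerAl bf.1.
- by rewrite mulrDl -scalerAl bf.2.
Qed.

Lemma bilin_mulr (W : lmodType K) (f : A -> B -> W) a b : bilin f ->
  bilin (fun a' b' => f (a * a') (b * b')).
Proof.
move=> bf; split=> [b' k x y|a' k x y].
- by rewrite mulrDr -scalerAr bf.1.
- by rewrite mulrDr -scalerAr bf.2.
Qed.

Lemma tprod_evM (W : lmodType K) (f : A -> B -> W) (x y : T) : bilin f ->
  tprod_ev f (tmul x y) =
  tprod_ev (fun a b => tprod_ev (fun a' b' => f (a * a') (b * b')) y) x.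
Proof.
by move=> bf; rewrite tprod_evE // /tprod_ev /bsum big_allpairs_dep.
Qed.

Lemma tprod_ev_exch (W : lmodType K) (f : A -> B -> A -> B -> W) (x y : T) :
  tprod_ev (fun a b => tprod_ev (f a b) y) x =
  tprod_ev (fun a' b' => tprod_ev (fun a b => f a b a' b') x) y.
Proof. by rewrite /tprod_ev /bsum exchange_big. Qed.

Lemma eq_tprod_ev (W : lmodType K) (f g : A -> B -> W) (x : T) :
  (forall a b, f a b = g a b) -> tprod_ev f x = tprod_ev g x.
Proof. by move=> fg; apply: eq_bigr => p _; exact: fg. Qed.

Lemma tmulA : associative tmul.
Proof.
move=> x y z; apply: tprod_ext => W f bf.
rewrite !tprod_evM //; last exact: bilin_mull.
apply: eq_tprod_ev => a b; rewrite tprod_evM; last exact: bilin_mulr.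
by apply: eq_tprod_ev => a' b'; apply: eq_tprod_ev => a'' b''; rewrite !mulrA.
Qed.
Lemma tmulC : commutative tmul.
Proof.
move=> x y; apply: tprod_ext => W f bf; rewrite !tprod_evM // tprod_ev_exch.
apply: eq_tprod_ev => a b; apply: eq_tprod_ev => a' b'.
by rewrite [a * _]mulrC [b * _]mulrC.
Qed.
Lemma tmul1 : left_id tone tmul.
Proof.
move=> x; apply: tprod_ext => W f bf; rewrite tprod_evM //.
rewrite tprod_ev_pure; last exact: bilin_mull.
by apply: eq_tprod_ev => a b; rewrite !mul1r.
Qed.
Lemma tmulDl : left_distributive tmul +%R.
Proof.
move=> x y z; change (tmul (tprod_add x y) z =
  tprod_add (tmul x z) (tmul y z)).
apply: tprod_ext => W f bf.
rewrite tprod_evM // (tprod_evD (bilin_mull z bf)) (tprod_evD bf).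
by rewrite !tprod_evM.
Qed.

Lemma bilin_mulK (U V : lmodType K) (f : {linear U -> K^o})
    (g : {linear V -> K^o}) : bilin (fun u v => f u * g v : K^o).
Proof.
split=> [v k x y|u k x y].
- by rewrite linearP mulrDl -scalerAl.
- by rewrite linearP mulrDr -scalerAr.
Qed.

Lemma tone_neq0 : tone != 0.
Proof.
pose e1 : {lrmorphism A -> K^o} := sym_lift \0.
pose e2 : {lrmorphism B -> K^o} := sym_lift \0.
have bf : bilin (fun a b => e1 a * e2 b : K^o) := bilin_mulK e1 e2.
apply/eqP => /(congr1 (tprod_lift bf)).
rewrite linear0 [LHS]tprod_lift_pure (rmorph1 e1) (rmorph1 e2) mulr1 => /eqP.
by rewrite oner_eq0.
Qed.

HB.instance Definition _ := GRing.Zmodule_isComNzRing.Build T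
  tmulA tmulC tmul1 tmulDl tone_neq0.

Lemma tscaleAl k (x y : T) : k *: (x * y) = (k *: x) * y.
Proof.
change (tprod_scale k (tmul x y) = tmul (tprod_scale k x) y).
apply: tprod_ext => W f bf.
by rewrite tprod_evM // (tprod_evZ bf) (tprod_evZ (bilin_mull y bf)) tprod_evM.
Qed.
HB.instance Definition _ := GRing.Lmodule_isLalgebra.Build K T tscaleAl.
HB.instance Definition _ := GRing.Lalgebra_isComAlgebra.Build K T.

Lemma pureM (a a' : A) (b b' : B) :
  (pure a b : T) * (pure a' b' : T) = pure (a * a') (b * b').
Proof.
change (tmul (pure a b) (pure a' b') = pure (a * a') (b * b')).
apply: tprod_ext => W f bf.
rewrite tprod_evM // (tprod_ev_pure _ _ (bilin_mull _ bf)).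
by rewrite (tprod_ev_pure _ _ (bilin_mulr _ _ bf)) tprod_ev_pure.
Qed.
End SymTProd.

Section Dual.
Variables (K : fieldType).

Definition dual (W : lmodType K) := {linear W -> K^o}.

(* [A^d]; the space [A^{*d}] is taken in the form [(A^d)^*]. *)
Definition dpow (d : nat) (A : lmodType K) : lmodType K := {ffun 'I_d -> A}.

Definition dpow_single d (A : lmodType K) (i : 'I_d) (a : A) : dpow d A :=
  [ffun k => if k == i then a else 0].

Lemma dpow_map_subproof d (A B : lmodType K) (j : {linear B -> A}) :
  linear (fun x : dpow d B => [ffun i => j (x i)] : dpow d A).
Proof. by move=> k x y; apply/ffunP => i; rewrite !ffunE linearP. Qed.
Definition dpow_map d (A B : lmodType K) (j : {linear B -> A}) :
  {linear dpow d B -> dpow d A} := lin_of (@dpow_map_subproof d A B j).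

Definition pullback d (A B : lmodType K) (phi : dual (dpow d A))
  (j : {linear B -> A}) : dual (dpow d B) := phi \o dpow_map d j.

(* [f (x) g], with [C (x) C] identified with [C]. *)
Definition tdual (U V : lmodType K) (f : dual U) (g : dual V) :
  dual (tprod U V) := tprod_lift (bilin_mulK f g).

Definition schar (W : lmodType K) (phi : dual W) : {lrmorphism sym W -> K^o} :=
  sym_lift phi.

Definition scounit (W : lmodType K) : {lrmorphism sym W -> K^o} := schar \0.

(* The functional which is [psi] on [W] and [0] on the [n]-fold products of
   elements of [W], [n <> 1]: since [S(psi 'X)] maps such a product to a
   multiple of ['X^n], it is the coefficient of ['X] in [S(psi 'X)]. *)
Lemma sdelta_subproof1 (W : lmodType K) (psi : dual W) :
  linear (fun w => (psi w : K) *: 'X : {poly K}).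
Proof. by move=> k x y; rewrite linearP scalerDl -scalerA. Qed.
Definition sdelta_poly (W : lmodType K) (psi : dual W) :
  {lrmorphism sym W -> {poly K}} := sym_lift (lin_of (sdelta_subproof1 psi)).
Lemma sdelta_subproof2 (W : lmodType K) (psi : dual W) :
  linear (fun x => (sdelta_poly psi x)`_1 : K^o).
Proof. by move=> k x y; rewrite linearP coefD coefZ. Qed.
Definition sdelta (W : lmodType K) (psi : dual W) : dual (sym W) :=
  lin_of (sdelta_subproof2 psi).

Lemma sdelta_in (W : lmodType K) (psi : dual W) w :
  sdelta psi (sym_in W w) = psi w.
Proof.
have e : sdelta_poly psi (sym_in W w) = (psi w : K) *: 'X by exact: sym_lift_in.
by apply: (etrans (congr1 (fun p : {poly K} => p`_1) e)); rewrite coefZ coefX mulr1.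
Qed.

Lemma sdelta_prod (W : lmodType K) (psi : dual W) n (w : 'I_n -> W) :
  n != 1%N -> sdelta psi (\prod_(i < n) sym_in W (w i)) = 0.
Proof.
move=> n1.
have e : sdelta_poly psi (\prod_(i < n) sym_in W (w i)) =
    (\prod_(i < n) (psi (w i) : K)) *: 'X^n.
  apply: (etrans (rmorph_prod (sdelta_poly psi) _ _ _)).
  rewrite (eq_bigr (fun i => (psi (w i) : K) *: 'X)); last first.
    by move=> i _; exact: sym_lift_in.
  by rewrite scaler_prod prodr_const card_ord.
apply: (etrans (congr1 (fun p : {poly K} => p`_1) e)).
by rewrite coefZ coefXn eq_sym (negbTE n1) mulr0.
Qed.
End Dual.

Section PFSum.
Variables (K : fieldType) (I : choiceType) (W : lmodType K) (F : I -> dual W).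

Definition pointwise_finite : Prop :=
  forall x : W, finite_set [set i | F i x != 0].

Lemma pfsum_linear : pointwise_finite ->
  linear (fun x => (\sum_(i \in [set: I]) F i x : K^o)).
Proof.
move=> fin k x y.
pose S := fset_set ([set i | F i x != 0] `|` [set i | F i y != 0])%classic.
have S0 i : i \notin S -> F i x = 0 /\ F i y = 0.
  rewrite in_fset_set; last by rewrite finite_setU; split; exact: fin.
  rewrite notin_setE => /= /not_orP[] h1 h2.
  by split; apply/eqP; apply: contrapT => /negP h; [apply: h1|apply: h2].
rewrite !(@fsbigTE _ _ _ _ S); try by move=> i /S0[h1 h2]; rewrite ?linearP ?h1 ?h2 ?scaler0 ?addr0.
rewrite scaler_sumr -big_split; apply: eq_bigr => i _; exact: linearP.
Qed.

(* The sum of a family of functionals that is finite at each point (and, by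
   convention, [0] for any other family). *)
Definition pfsum : dual W :=
  if pselect pointwise_finite is left fin then lin_of (pfsum_linear fin) else \0.
End PFSum.

Section UProd.
Variables (K : fieldType) (d m : nat).

Section Alternating.
Variables (A1 A2 : nalgType K).

Definition letter (x : A1 + A2) : fp2 A1 A2 :=
  match x with inl a => fp2_in1 A1 A2 a | inr a => fp2_in2 A1 A2 a end.

Definition alternate (x y : A1 + A2) : bool :=
  match x, y with inl _, inr _ | inr _, inl _ => true | _, _ => false end.

Fixpoint letters_prod (x : A1 + A2) (s : seq (A1 + A2)) : fp2 A1 A2 :=
  if s is y :: s' then nmul (letter x) (letters_prod y s') else letter x.
End Alternating.

Definition functional (A : nalgType K) := dual (dpow d A).

Record uprod := UProd {
  uprod_op :> forall A1 A2 : algP K m,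
    functional A1 -> functional A2 -> functional (algP_fp2 A1 A2);
  uprod_natural : forall (A1 A2 B1 B2 : algP K m)
    (j1 : nhom B1 A1) (j2 : nhom B2 A2), algP_mor j1 -> algP_mor j2 ->
    forall (phi1 : functional A1) (phi2 : functional A2),
    pullback (uprod_op phi1 phi2) (fp2_map j1 j2) =1
    uprod_op (pullback phi1 j1) (pullback phi2 j2);
  uprod_nondegenerate :
    ~ (forall (A1 A2 : algP K m) (phi1 : functional A1) (phi2 : functional A2)
         (i : 'I_d) (x : A1 + A2) (s : seq (A1 + A2)),
         (0 < size s)%N -> path (@alternate A1 A2) x s ->
         uprod_op phi1 phi2 (dpow_single i (letters_prod x s)) = 0)
}.

Implicit Types op : uprod.

Definition uprod_unital op : Prop :=
  forall (A1 A2 : algP K m) (phi1 : functional A1) (phi2 : functional A2),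
    pullback (op A1 A2 phi1 phi2) (fp2_in1 A1 A2) =1 phi1 /\
    pullback (op A1 A2 phi1 phi2) (fp2_in2 A1 A2) =1 phi2.

Definition uprod_assoc op : Prop :=
  forall (A1 A2 A3 : algP K m) (phi1 : functional A1) (phi2 : functional A2)
    (phi3 : functional A3),
    op _ _ (op _ _ phi1 phi2) phi3 =1
    pullback (op _ _ phi1 (op _ _ phi2 phi3)) (fp2_assoc A1 A2 A3).

Definition uau op : Prop := uprod_unital op /\ uprod_assoc op.

Definition uprod_symmetric op : Prop :=
  forall (A1 A2 : algP K m) (phi1 : functional A1) (phi2 : functional A2),
    op _ _ phi1 phi2 =1 pullback (op _ _ phi2 phi1) (fp2_swap A1 A2).

Definition is_sigma op (A1 A2 : algP K m)
    (s : {linear dpow d (fp2 A1 A2) ->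
                 tprod (sym (dpow d A1)) (sym (dpow d A2))}) : Prop :=
  forall (phi1 : functional A1) (phi2 : functional A2) x,
    op A1 A2 phi1 phi2 x = tdual (schar phi1) (schar phi2) (s x).

(* Definite description: the elements of the tensor product are separated by
   the functionals [tdual (schar phi1) (schar phi2)], so that there is at most
   one such map, necessarily linear. *)
Definition sigma op (A1 A2 : algP K m) :
    {linear dpow d (fp2 A1 A2) -> tprod (sym (dpow d A1)) (sym (dpow d A2))} :=
  if pselect (exists s, is_sigma op (A1 := A1) (A2 := A2) s) is left ex
  then projT1 (cid ex) else \0.

End UProd.

Section Conv.
Variables (K : fieldType) (d m : nat) (op : uprod K d m) (V : lmodType K).

Definition tens_copies : algP K m := algP_fprod (fun _ : 'I_m => tens V).
Definition Espace : lmodType K := dpow d tens_copies.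

Definition tens_delta : nhom (tens V) (fp2 (tens V) (tens V)) :=
  tens_lift ((fp2_in1 (tens V) (tens V) \o tens_in V) \+
             (fp2_in2 (tens V) (tens V) \o tens_in V)).

Definition copies_delta : nhom tens_copies (fp2 tens_copies tens_copies) :=
  let inl := fprod_in (fun _ : 'I_m => tens V) in
  fprod_lift (fun l => nhom_comp (fp2_map (inl l) (inl l)) tens_delta).

Definition conv (phi1 phi2 : dual Espace) : dual Espace :=
  pullback (op tens_copies tens_copies phi1 phi2) copies_delta.

Definition scoprod : {lrmorphism sym Espace -> tprod (sym Espace) (sym Espace)} :=
  sym_lift (sigma op tens_copies tens_copies \o dpow_map d copies_delta).

Definition sconv (Phi1 Phi2 : dual (sym Espace)) : dual (sym Espace) :=
  tdual Phi1 Phi2 \o scoprod.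

Definition sconv_exp (Phi : dual (sym Espace)) (n : nat) : dual (sym Espace) :=
  iter n (sconv Phi) (scounit Espace).

Definition ln_coef (l : nat) : K := (-1) ^+ l.+1 / l%:R.

Definition ln_star (Phi : dual (sym Espace)) : dual (sym Espace) :=
  pfsum (fun l : nat =>
    ln_coef l.+1 \*: sconv_exp (Phi \- scounit Espace) l.+1 : dual _).

Definition ln_op (phi : dual Espace) : dual Espace :=
  ln_star (schar phi) \o sym_in Espace.
End Conv.

(* A formal power series in two noncommuting variables [X] (letter [false]) and
   [Y] (letter [true]) is given by its coefficients on words. *)
Section CBH.
Variable K : fieldType.
Implicit Types f g : seq bool -> K.

Definition ncs_one (w : seq bool) : K := (w == [::])%:R.

Definition ncs_mul f g (w : seq bool) : K :=
  \sum_(i < (size w).+1) f (take i w) * g (drop i w).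

Definition ncs_exp_letter (b : bool) (w : seq bool) : K :=
  if all (pred1 b) w then (size w)`!%:R^-1 else 0.

(* If [f] has constant term [1], then [(f - 1)^l] vanishes on the words of
   length less than [l]. *)
Definition ncs_ln f (w : seq bool) : K :=
  \sum_(1 <= l < (size w).+1)
    ln_coef K l * iter l (ncs_mul (f \- ncs_one)) ncs_one w.

Definition cbh_coef : seq bool -> K :=
  ncs_ln (ncs_mul (ncs_exp_letter false) (ncs_exp_letter true)).

Variables (d m : nat) (op : uprod K d m) (V : lmodType K).

Definition sconv_word (x y : dual (sym (Espace d m V))) (w : seq bool) :
    dual (sym (Espace d m V)) :=
  foldr (fun b => sconv op (if b then y else x)) (scounit _) w.

Definition CBH (x y : dual (sym (Espace d m V))) : dual (sym (Espace d m V)) :=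
  pfsum (fun w : seq bool => cbh_coef w \*: sconv_word x y w : dual _).
End CBH.

(* Main.v *)
(* Write [S(phi)] for the character of [S(E)] extending [phi] and [phi_v] for the
   convolution of a word [v] in [phi1, phi2].  For [x] in [S(E)] the function
   [v |-> S(phi_v)(x)] has finite degree, that is, it is killed by all long
   enough iterated differences: for [x] a monomial with [n] letters, each
   difference spends a letter.  Hence long convolution words in the functionals
   [S(phi_i) - eps] vanish at [x], and [k |-> S(phi^k)(x)] is a polynomial
   [Q_x(k)] with [ln S(phi)(x) = Q_x'(0)].  Since [Q_xy = Q_x Q_y], the logarithm of
   a character is a derivation, so it equals [D(ln phi)]; by Taylor's formula its
   exponential is [Q_x(1) = S(phi)(x)].  Substituting the two logarithms for [X]
   and [Y] in the formal series [ln(e^X e^Y)] then gives the first formula.  If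
   [phi1] and [phi2] commute, [S((phi1 * phi2)^k) = S(phi1^k) * S(phi2^k)], and
   differentiating at [k = 0] gives the second.

   Coassociativity of the coproduct is not needed: the convolution is associative
   on characters, hence on the pointwise limits of their linear combinations,
   which contain all functionals that occur. *)
Require Import Defs.
From mathcomp Require Import all_boot all_order all_algebra.
From mathcomp Require Import boolp classical_sets cardinality fsbigop.
From mathcomp Require Import reals complex ring.

Set Implicit Arguments.
Unset Strict Implicit.
Unset Printing Implicit Defensive.

Import GRing.Theory.
Local Open Scope ring_scope.

(** * Extensionality, non-unital algebras and direct powers *)

Lemma dual_ext (K : fieldType) (W : lmodType K) (f g : dual W) : f =1 g -> f = g.
Proof.
(* Linear maps are packed records: once the functions agree, the other fields are proofs and agree
   by proof irrelevance. *)
case: f g => [f [[f1] [f2]]] [g [[g1] [g2]]] /= /funext e.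
case: _ / e in g1 g2 *.
by rewrite (Prop_irrelevance f1 g1) (Prop_irrelevance f2 g2).
Qed.

Section NAlgebraTheory.
Variable K : fieldType.

Lemma nmul0l (A : nalgType K) (x : A) : nmul 0 x = 0.
Proof. exact: (linear0 (lin_of (nmul_linl x))). Qed.
Lemma nmul0r (A : nalgType K) (x : A) : nmul x 0 = 0.
Proof. exact: (linear0 (lin_of (nmul_linr x))). Qed.
Lemma nmulBl (A : nalgType K) (x y z : A) : nmul (x - y) z = nmul x z - nmul y z.
Proof. exact: (linearB (lin_of (nmul_linl z))). Qed.
Lemma nmulBr (A : nalgType K) (x y z : A) : nmul x (y - z) = nmul x y - nmul x z.
Proof. exact: (linearB (lin_of (nmul_linr x))). Qed.
End NAlgebraTheory.

Section DirectPower.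
Variables (K : fieldType) (d : nat) (A : lmodType K).

Lemma dpow_single0 i : dpow_single i 0 = 0 :> dpow d A.
Proof. by apply/ffunP => k; rewrite !ffunE if_same. Qed.

Lemma dpow_sum_single (x : dpow d A) : x = \sum_i dpow_single i (x i).
Proof.
apply/ffunP => k; rewrite sum_ffunE (bigD1 k) //= ffunE eqxx big1 ?addr0 //.
by move=> j jk; rewrite ffunE eq_sym (negPf jk).
Qed.
End DirectPower.

(** * The convolution of functionals and its unit *)

Section UniversalProduct.
Variables (K : fieldType) (d m : nat) (op : uprod K d m).
Implicit Types A B : algP K m.

Lemma pullback_single (A B : nalgType K) (phi : functional d A) (j : nhom B A) i b :
  pullback phi j (dpow_single i b) = phi (dpow_single i (j b)).
Proof.
congr (phi _); apply/ffunP => k; rewrite !ffunE.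
by case: ifP => // _; rewrite linear0.
Qed.

Lemma algP_mor_in1 A B : @algP_mor K m A (algP_fp2 A B) (fp2_in1 A B).
Proof.
move=> l x Ax; exists (fp2_in1 _ _ (Sub x (asboolT Ax) : subalg_alg (algP_sub A l))) => //.
exact: fp2_lift_in1.
Qed.

(** In the non-unital setting the zero map is a homomorphism; the zero functional is a pullback
    along it, so that naturality applies to it. *)
Lemma nhom0_subproof (A B : nalgType K) : is_nhom (\0 : {linear A -> B}).
Proof.
split; first exact: linearP.
by move=> x y /=; exact/esym/(linear0 (lin_of (nmul_linr _))).
Qed.
Definition nhom0 (A B : nalgType K) : nhom A B := nhom_of (nhom0_subproof A B).

Lemma algP_mor0 A B : @algP_mor K m A B (nhom0 A B).
Proof. by move=> l x _; exact: subalg0. Qed.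

Lemma uprod_naturalE A1 A2 B1 B2 (j1 : nhom B1 A1) (j2 : nhom B2 A2)
    (phi1 : functional d A1) (phi2 : functional d A2) i b :
  algP_mor j1 -> algP_mor j2 ->
  op _ _ (pullback phi1 j1) (pullback phi2 j2) (dpow_single i b) =
  op _ _ phi1 phi2 (dpow_single i (fp2_map j1 j2 b)).
Proof.
move=> m1 m2; rewrite -(uprod_natural op m1 m2).
exact: (@pullback_single (fp2 A1 A2) (fp2 B1 B2)).
Qed.

Variable V : lmodType K.
Let D := tens_copies m V.
Let Delta := copies_delta m V.

Definition tens_gen (l : 'I_m) (v : V) : D :=
  fprod_in (fun _ : 'I_m => tens V) l (tens_in V v).

Lemma copies_delta_in l (a : tens V) :
  Delta (fprod_in (fun _ : 'I_m => tens V) l a) =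
  fp2_map (fprod_in (fun _ : 'I_m => tens V) l)
    (fprod_in (fun _ : 'I_m => tens V) l) (tens_delta V a).
Proof. exact: fprod_lift_in. Qed.

Lemma copies_delta_gen l v :
  Delta (tens_gen l v) =
  fp2_in1 D D (tens_gen l v) + fp2_in2 D D (tens_gen l v).
Proof.
rewrite /tens_gen copies_delta_in [X in fp2_map _ _ X]tens_lift_in linearD.
by congr (_ + _); [exact: fp2_lift_in1 | exact: fp2_lift_in2].
Qed.

Lemma algP_mor_delta : @algP_mor K m D (algP_fp2 D D) Delta.
Proof.
move=> l _ [a _ <-]; rewrite copies_delta_in.
(* The distinguished subalgebra of the free product is an image, so a preimage is exhibited:
   corestrict the embedding of [T(V)] to the [l]-th subalgebra on both sides of [tens_delta]. *)
have im (b : tens V) : subalg_set (algP_sub D l) (fprod_in _ l b) by exists b.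
pose c := corestr im : nhom (tens V) (subalg_alg (algP_sub D l)).
exists (fp2_map c c (tens_delta V a)) => //.
have := @fp2_uniq _ _ _ _ (nhom_comp (fp2_map (subalg_incl (algP_sub D l))
  (subalg_incl (algP_sub D l))) (fp2_map c c))
  (fp2_map (fprod_in (fun _ : 'I_m => tens V) l) (fprod_in (fun _ : 'I_m => tens V) l)).
apply=> b; rewrite nhom_compE.
- rewrite [X in fp2_map _ _ X]fp2_lift_in1 nhom_compE.
  by rewrite [LHS]fp2_lift_in1 [RHS]fp2_lift_in1.
- rewrite [X in fp2_map _ _ X]fp2_lift_in2 nhom_compE.
  by rewrite [LHS]fp2_lift_in2 [RHS]fp2_lift_in2.
Qed.

Lemma tens_copies_uniq (B : nalgType K) (g h : nhom D B) :
  (forall l v, g (tens_gen l v) = h (tens_gen l v)) -> g =1 h.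
Proof.
move=> gh; apply: fprod_uniq => l; pose inl := fprod_in (fun _ : 'I_m => tens V) l.
have := @tens_uniq _ _ _ (nhom_comp g inl) (nhom_comp h inl).
by apply=> v; exact: gh.
Qed.

Lemma tens_copies_ind (Q : D -> Prop) :
  (forall l v, Q (tens_gen l v)) -> Q 0 ->
  (forall k x y, Q x -> Q y -> Q (k *: x + y)) ->
  (forall x y, Q x -> Q y -> Q (nmul x y)) -> forall x, Q x.
Proof.
move=> hg h0 hP hM; apply: fprod_ind => // l; apply: palg_ind.
- exact: hg.
- by rewrite linear0.
- by move=> x Qx; rewrite linearN; have := hP (-1) _ _ Qx h0; rewrite addr0 scaleN1r.
- by move=> x y Qx Qy; rewrite linearD; have := hP 1 _ _ Qx Qy; rewrite scale1r.
- by move=> k x Qx; rewrite linearZ; have := hP k _ _ Qx h0; rewrite addr0.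
- by move=> x y Qx Qy; rewrite nhomM; exact: hM.
Qed.

Notation E := (Espace d m V).
Implicit Types phi psi chi : dual E.

Definition zero_dual : dual E := \0.

Lemma functional_ext (A : nalgType K) (f g : functional d A) :
  (forall i a, f (dpow_single i a) = g (dpow_single i a)) -> f = g.
Proof.
move=> fg; apply: dual_ext => x.
by rewrite (dpow_sum_single x) !linear_sum; apply: eq_bigr.
Qed.

Lemma pullback_id (A : nalgType K) (f : functional d A) : pullback f (nhom_id A) = f.
Proof. by apply: functional_ext => i a; rewrite pullback_single. Qed.

Lemma conv_single phi psi i a :
  conv op phi psi (dpow_single i a) = op D D phi psi (dpow_single i (Delta a)).
Proof. exact: pullback_single. Qed.

Hypothesis op_uau : uau op.

Lemma uprod_in1 A B f1 f2 i a :
  op A B f1 f2 (dpow_single i (fp2_in1 A B a)) = f1 (dpow_single i a).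
Proof. by rewrite -(op_uau.1 A B f1 f2).1 pullback_single. Qed.

Lemma uprod_in2 A B f1 f2 i a :
  op A B f1 f2 (dpow_single i (fp2_in2 A B a)) = f2 (dpow_single i a).
Proof. by rewrite -(op_uau.1 A B f1 f2).2 pullback_single. Qed.

Lemma pullback0 (A B : algP K m) (f : functional d A) :
  pullback f (nhom0 B A) = \0 :> functional d B.
Proof.
apply: functional_ext => i b; rewrite pullback_single.
by rewrite dpow_single0 linear0.
Qed.

(** Naturality along the zero and the identity map composes [Delta] with a map that kills the first
    summand of each generator. The result is the second embedding, where the unit property
    applies. *)
Lemma conv0l phi : conv op zero_dual phi = phi.
Proof.
apply: functional_ext => i a; rewrite conv_single.
transitivity (op D D (pullback (zero_dual : functional d D) (nhom0 D D))
  (pullback (phi : functional d D) (nhom_id D)) (dpow_single i (Delta a))).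
  by rewrite pullback_id pullback0.
rewrite uprod_naturalE //; last exact: algP_mor0.
have e : nhom_comp (fp2_map (nhom0 D D) (nhom_id D)) Delta =1 fp2_in2 D D.
  apply: tens_copies_uniq => l v; rewrite nhom_compE copies_delta_gen linearD.
  by rewrite [X in X + _]fp2_lift_in1 [X in _ + X]fp2_lift_in2 !nhom_compE linear0 add0r.
by rewrite -(nhom_compE (fp2_map _ _)) e uprod_in2.
Qed.

Lemma conv0r phi : conv op phi zero_dual = phi.
Proof.
apply: functional_ext => i a; rewrite conv_single.
transitivity (op D D (pullback (phi : functional d D) (nhom_id D))
  (pullback (zero_dual : functional d D) (nhom0 D D)) (dpow_single i (Delta a))).
  by rewrite pullback_id pullback0.
rewrite uprod_naturalE //; last exact: algP_mor0.
have e : nhom_comp (fp2_map (nhom_id D) (nhom0 D D)) Delta =1 fp2_in1 D D.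
  apply: tens_copies_uniq => l v; rewrite nhom_compE copies_delta_gen linearD.
  by rewrite [X in X + _]fp2_lift_in1 [X in _ + X]fp2_lift_in2 !nhom_compE linear0 addr0.
by rewrite -(nhom_compE (fp2_map _ _)) e uprod_in1.
Qed.

End UniversalProduct.

(** * Functions of finite degree on words *)

Section WordFunctions.
Variable K : fieldType.
Implicit Types f g : seq bool -> K.

Definition wdiff f (b : bool) (v : seq bool) : K := f (b :: v) - f v.

(** Analogue of the polynomials of degree less than [n]: [n = 0] leaves the zero function, [n = 1]
    the constants. *)
Fixpoint wdeg_lt (n : nat) f : Prop :=
  if n is n'.+1 then forall b, wdeg_lt n' (wdiff f b) else forall v, f v = 0.

Lemma wdeg_ltS n f : wdeg_lt n f -> wdeg_lt n.+1 f.
Proof.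
elim: n f => [|n IH] f /= hf b; last exact: IH.
by move=> v; rewrite /wdiff !hf subrr.
Qed.

Lemma wdeg_lt_le n p f : (n <= p)%N -> wdeg_lt n f -> wdeg_lt p f.
Proof. by move=> /subnKC <- hf; elim: (p - n)%N => [|k]; rewrite ?addn0 // addnS => /wdeg_ltS. Qed.

Lemma wdeg_lt_lin n k f g :
  wdeg_lt n f -> wdeg_lt n g -> wdeg_lt n (fun v => k * f v + g v).
Proof.
elim: n f g => [|n IH] f g hf hg /= => [v|b]; first by rewrite hf hg mulr0 addr0.
rewrite (_ : wdiff _ b = fun v => k * wdiff f b v + wdiff g b v); first exact: IH.
by apply/funext => v; rewrite /wdiff mulrBr opprD addrACA.
Qed.

Lemma wdeg_lt0 n : wdeg_lt n (fun=> 0).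
Proof. exact: (@wdeg_lt_le 0). Qed.

(** Discrete Leibniz rule: the difference of a product has three terms, each with a smaller sum of
    bounds. One of them lowers both bounds, hence the induction on an upper bound [s] of [n + p]. *)
Lemma wdeg_lt_mul n p f g :
  wdeg_lt n f -> wdeg_lt p g -> wdeg_lt (n + p) (fun v => f v * g v).
Proof.
move: {2}(n + p)%N (leqnn (n + p)) => s.
elim: s n p f g => [|s IH] [|n] [|p] f g // le_np hf hg.
1,2: rewrite (_ : (fun v => _) = fun=> 0); [exact: wdeg_lt0|].
1,2: by apply/funext => v; rewrite hf mul0r.
- rewrite (_ : (fun v => _) = fun=> 0); first exact: wdeg_lt0.
  by apply/funext => v; rewrite hf mul0r.
- rewrite (_ : (fun v => _) = fun=> 0); first exact: wdeg_lt0.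
  by apply/funext => v; rewrite hg mulr0.
move=> b; change (wdeg_lt (n + p.+1)%N (wdiff (fun v => f v * g v) b)).
rewrite (_ : wdiff _ b = fun v => 1 * (wdiff f b v * g v) +
   (1 * (f v * wdiff g b v) + wdiff f b v * wdiff g b v)).
  have lt1 : (n + p < s)%N by rewrite -ltnS -addSn -addnS.
  apply: wdeg_lt_lin; first by apply: IH => //; rewrite addnS.
  rewrite addnS -addSn; apply: wdeg_lt_lin; first by apply: IH => //; rewrite addSn.
  apply: (@wdeg_lt_le (n + p)); first by rewrite addSn.
  by apply: IH => //; exact: ltnW.
by apply/funext => v; rewrite /wdiff; ring.
Qed.

Definition wdiffs (w : seq bool) f := foldl wdiff f w.

Lemma wdiffs_deg n f w v : wdeg_lt n f -> (n <= size w)%N -> wdiffs w f v = 0.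
Proof.
elim: w n f => [|b w IH] [|n] f hf //= le_n.
- apply: (IH 0%N) => // u; by rewrite /wdiff !hf subrr.
- exact: (IH n).
Qed.
End WordFunctions.

(** * Associativity of the convolution and finite degree of its words *)

Section FiniteDegree.
Variables (K : fieldType) (d m : nat) (op : uprod K d m).
Variable V : lmodType K.
Hypothesis op_uau : uau op.
Notation D := (tens_copies m V).
Notation E := (Espace d m V).
Notation Delta := (copies_delta m V).

Lemma uprod_assocE (A1 A2 A3 : algP K m) (f1 : functional d A1)
    (f2 : functional d A2) (f3 : functional d A3) i a :
  op _ _ (op _ _ f1 f2) f3 (dpow_single i a) =
  op _ _ f1 (op _ _ f2 f3) (dpow_single i (fp2_assoc A1 A2 A3 a)).
Proof.
rewrite op_uau.2.
exact: (@pullback_single _ _ (fp2 A1 (fp2 A2 A3)) (fp2 (fp2 A1 A2) A3)).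
Qed.

(** Naturality moves the inner coproduct into the argument on both sides. What remains is
    coassociativity of [Delta] up to the associator; on a generator both sides are the sum of its
    three embeddings. *)
Lemma convA (f1 f2 f3 : dual E) :
  conv op f1 (conv op f2 f3) = conv op (conv op f1 f2) f3.
Proof.
apply: functional_ext => i a; rewrite !conv_single.
transitivity (op D D (pullback (f1 : functional d D) (nhom_id D))
   (conv op f2 f3) (dpow_single i (Delta a))); first by rewrite pullback_id.
rewrite (uprod_naturalE op f1 (op D D f2 f3)) //; last exact: algP_mor_delta.
transitivity (op D D (conv op f1 f2) (pullback (f3 : functional d D) (nhom_id D))
  (dpow_single i (Delta a))); last by rewrite pullback_id.
rewrite (uprod_naturalE op (op D D f1 f2) f3) //; last exact: algP_mor_delta.
rewrite uprod_assocE; congr (op D _ f1 _ (dpow_single i _)).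
have := @tens_copies_uniq _ _ _ _ (nhom_comp (fp2_map (nhom_id D) Delta) Delta)
 (nhom_comp (fp2_assoc D D D) (nhom_comp (fp2_map Delta (nhom_id D)) Delta)).
apply=> l v; rewrite !nhom_compE !copies_delta_gen !linearD.
rewrite [in LHS]fp2_lift_in1 [in LHS]fp2_lift_in2 !nhom_compE copies_delta_gen linearD.
rewrite [in RHS]fp2_lift_in1 [X in _ + fp2_assoc _ _ _ X]fp2_lift_in2 !nhom_compE.
rewrite copies_delta_gen !linearD.
by rewrite [in RHS]fp2_lift_in1 [in RHS]fp2_lift_in1 !fp2_lift_in1 !fp2_lift_in2 !nhom_compE addrA.
Qed.

(** [fp2_split] doubles each letter of [D] by [Delta] and lets the first half join [A]; [fp2_skip]
    sends the letter wholly to the last factor. They describe a convolution with and without one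
    more functional in front. *)
Definition fp2_split (A : nalgType K) : nhom (fp2 A D) (fp2 (fp2 A D) D) :=
  fp2_lift (nhom_comp (fp2_in1 (fp2 A D) D) (fp2_in1 A D))
    (nhom_comp (fp2_map (fp2_in2 A D) (nhom_id D)) Delta).

Definition fp2_skip (A : nalgType K) : nhom (fp2 A D) (fp2 (fp2 A D) D) :=
  fp2_map (fp2_in1 A D) (nhom_id D).

(* The index bounds one plus the number of letters taken from [D]; the bound
   need not be sharp, except that [letter_filt 0] is zero. *)
Inductive letter_filt (A : nalgType K) : nat -> fp2 A D -> Prop :=
| LFzero : letter_filt 0 0
| LFin1 c : letter_filt 1 (fp2_in1 A D c)
| LFin2 l v : letter_filt 2 (fp2_in2 A D (tens_gen l v))
| LFle n x : letter_filt n x -> letter_filt n.+1 x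
| LFlin n k x y : letter_filt n x -> letter_filt n y -> letter_filt n (k *: x + y)
| LFmul n p x y : letter_filt n x -> letter_filt p y -> letter_filt (n + p) (nmul x y).

Lemma letter_filt0 (A : nalgType K) n (x : fp2 A D) : letter_filt n x -> n = 0%N -> x = 0.
Proof.
elim=> {n x} // [n k x y _ IHx _ IHy n0|n p x y _ IHx _ IHy /eqP].
  by rewrite IHx // IHy // scaler0 addr0.
by rewrite addn_eq0 => /andP[/eqP/IHx-> _]; rewrite nmul0l.
Qed.

Lemma letter_filt_le (A : nalgType K) n p (x : fp2 A D) :
  (n <= p)%N -> letter_filt n x -> letter_filt p x.
Proof.
by move=> /subnKC <- hx; elim: (p - n)%N => [|k IH]; rewrite ?addn0 // addnS; exact: LFle.
Qed.

Lemma letter_filtD (A : nalgType K) n (x y : fp2 A D) :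
  letter_filt n x -> letter_filt n y -> letter_filt n (x + y).
Proof. by move=> hx hy; rewrite -[x]scale1r; exact: LFlin. Qed.

Lemma fp2_split_gen (A : nalgType K) l v :
  fp2_split A (fp2_in2 A D (tens_gen l v)) =
  fp2_in1 _ D (fp2_in2 A D (tens_gen l v)) + fp2_in2 _ D (tens_gen l v).
Proof.
rewrite [LHS]fp2_lift_in2 nhom_compE copies_delta_gen linearD.
by congr (_ + _); [exact: fp2_lift_in1|exact: fp2_lift_in2].
Qed.

(** On a letter of [D] the difference is the half absorbed by the left factor, so the last factor
    receives nothing. For products, xy - x'y' = (x - x')y + x'(y - y'). *)
Lemma fp2_split_filt (A : nalgType K) n (x : fp2 A D) : letter_filt n x ->
  [/\ letter_filt n (fp2_split A x), letter_filt n (fp2_skip A x) &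
      letter_filt n.-1 (fp2_split A x - fp2_skip A x)].
Proof.
elim=> {n x}.
- by rewrite !linear0 addr0; split; exact: LFzero.
- move=> c.
  have -> : fp2_split A (fp2_in1 A D c) = fp2_in1 _ D (fp2_in1 A D c) by exact: fp2_lift_in1.
  have -> : fp2_skip A (fp2_in1 A D c) = fp2_in1 _ D (fp2_in1 A D c) by exact: fp2_lift_in1.
  by rewrite subrr; split; [exact: LFin1|exact: LFin1|exact: LFzero].
- move=> l v; rewrite fp2_split_gen.
  have -> : fp2_skip A (fp2_in2 A D (tens_gen l v)) = fp2_in2 _ D (tens_gen l v)
    by exact: fp2_lift_in2.
  rewrite addrK; split; [|exact: LFin2|exact: LFin1].
  by apply: letter_filtD; [exact/LFle/LFin1|exact: LFin2].
- move=> n x hx [h1 h2 h3]; split; [exact: LFle|exact: LFle|].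
  by apply: letter_filt_le h3; exact: leq_pred.
- move=> n k x y _ [x1 x2 x3] _ [y1 y2 y3]; rewrite !linearP.
  split; [exact: LFlin|exact: LFlin|].
  by rewrite addrACA -scalerDr; exact: LFlin.
- move=> n p x y hx [x1 x2 x3] hy [y1 y2 y3]; rewrite !nhomM.
  split; [exact: LFmul|exact: LFmul|].
  (* The predecessor is truncated at index 0, where the element itself is zero. *)
  case: n hx x1 x2 x3 => [|n] hx x1 x2 x3.
    rewrite (letter_filt0 hx) // !linear0 !nmul0l subrr.
    exact: letter_filt_le (LFzero _).
  case: p hy y1 y2 y3 => [|p] hy y1 y2 y3.
    rewrite (letter_filt0 hy) // !linear0 !nmul0r subrr.
    exact: letter_filt_le (LFzero _).
  have := letter_filtD (LFmul x3 y1) (letter_filt_le (leqnn _) (_ : letter_filt (n + p.+1) _)).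
  rewrite addSn /= => h.
  rewrite -(subrKA (nmul (fp2_skip A x) (fp2_split A y))) -nmulBl -nmulBr.
  by apply: h; rewrite addnS -addSn; exact: LFmul x2 y3.
Qed.

Variables phi1 phi2 : dual E.
Definition phi_at (b : bool) : dual E := if b then phi2 else phi1.

Definition conv_word (v : seq bool) : dual E :=
  foldr (fun b => conv op (phi_at b)) (zero_dual d m V) v.

(** Associativity and naturality: the associator after [fp2_split] is [Delta] on the second
    factor. *)
Lemma uprod_conv (A : algP K m) (chi : functional d A) (f g : dual E) i a :
  op A D chi (conv op f g) (dpow_single i a) =
  op _ D (op A D chi f) g (dpow_single i (fp2_split A a)).
Proof.
rewrite uprod_assocE.
transitivity (op A D (pullback chi (nhom_id A)) (conv op f g)
   (dpow_single i a)); first by rewrite pullback_id.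
rewrite (uprod_naturalE op chi (op D D f g)) //; last exact: algP_mor_delta.
congr (op A _ chi _ (dpow_single i _)).
have e : nhom_comp (fp2_assoc A D D) (fp2_map (fp2_in2 A D) (nhom_id D)) =1
    fp2_in2 A (fp2 D D).
  apply: fp2_uniq => b; rewrite nhom_compE.
    by rewrite [X in fp2_assoc _ _ _ X]fp2_lift_in1 [LHS]fp2_lift_in1 [LHS]fp2_lift_in2.
  by rewrite [X in fp2_assoc _ _ _ X]fp2_lift_in2 [LHS]fp2_lift_in2.
have := @fp2_uniq _ _ _ _ (fp2_map (nhom_id A) Delta)
  (nhom_comp (fp2_assoc A D D) (fp2_split A)).
apply=> b; rewrite nhom_compE.
  rewrite [LHS]fp2_lift_in1 [X in fp2_assoc _ _ _ X]fp2_lift_in1.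
  by rewrite [RHS]fp2_lift_in1 [RHS]fp2_lift_in1.
rewrite [LHS]fp2_lift_in2 [X in fp2_assoc _ _ _ X]fp2_lift_in2.
by rewrite (nhom_compE (fp2_map _ _)) -(nhom_compE (fp2_assoc _ _ _)) e.
Qed.

(** Naturality pulls the left functional back along the embedding of [A], where the unit property
    discards [f]. *)
Lemma uprod_skip (A : algP K m) (chi : functional d A) (f g : dual E) i a :
  op _ D (op A D chi f) g (dpow_single i (fp2_skip A a)) =
  op A D chi g (dpow_single i a).
Proof.
rewrite -(uprod_naturalE op (op A D chi f) g) //; last exact: algP_mor_in1.
rewrite pullback_id; congr (op A D _ g _).
by apply: functional_ext => k c; rewrite pullback_single uprod_in1.
Qed.

(* Prepending a factor to the convolution word splits each letter of [D] in two;
   the terms in which the new factor receives no letter are cancelled in the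
   difference, the other ones have lost a letter of [D]. *)
Lemma letter_filt_deg n (A : algP K m) (chi : functional d A) i (x : fp2 A D) :
  letter_filt n x ->
  wdeg_lt n (fun v => op A D chi (conv_word v) (dpow_single i x)).
Proof.
elim: n A chi x => [|n IH] A chi x hx /= => [v|b].
  by rewrite (letter_filt0 hx) // dpow_single0 linear0.
have [_ _ h] := fp2_split_filt hx.
rewrite (_ : wdiff _ b = fun v => op (algP_fp2 A D) D (op A D chi (phi_at b)) (conv_word v)
   (dpow_single i (fp2_split A x - fp2_skip A x))); first exact: IH.
apply/funext => v; rewrite /wdiff.
rewrite -[X in _ - X](uprod_skip chi (phi_at b)) [X in X - _]uprod_conv.
apply: (etrans (esym (linearB (op (algP_fp2 A D) D (op A D chi (phi_at b)) (conv_word v)) _ _))).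
congr (op _ _ _ _ _); apply/ffunP => k; rewrite !ffunE.
by case: ifP => _ //; rewrite subrr.
Qed.

Lemma conv_word_deg (e : E) : exists n, wdeg_lt n (fun v => conv_word v e).
Proof.
have single i a : exists n, wdeg_lt n (fun v => conv_word v (dpow_single i a)).
  (* The zero functional on a left factor [D] starts the induction: on the second embedding the
     product is the convolution word itself. *)
  suff [n hn] : exists n, letter_filt n (fp2_in2 D D a).
    exists n; have := letter_filt_deg (zero_dual d m V : functional d D) i hn.
    by congr wdeg_lt; apply/funext => v; rewrite uprod_in2.
  elim/tens_copies_ind: a => [l v||k x y [n hn] [p hp]|x y [n hn] [p hp]].
  - by exists 2%N; exact: LFin2.
  - by exists 0%N; rewrite linear0; exact: LFzero.
  - exists (n + p)%N; rewrite linearP; apply: LFlin.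
      by apply: letter_filt_le hn; rewrite leq_addr.
    by apply: letter_filt_le hp; rewrite leq_addl.
  - by exists (n + p)%N; rewrite nhomM; exact: LFmul.
rewrite (dpow_sum_single e).
elim/big_ind: _ => [|x y [n hn] [p hp]|i _]; last exact: single.
  exists 0%N => v; exact: linear0.
exists (n + p)%N.
rewrite (_ : (fun v => _) = fun v => 1 * conv_word v x + conv_word v y).
  apply: wdeg_lt_lin; first by apply: wdeg_lt_le hn; rewrite leq_addr.
  by apply: wdeg_lt_le hp; rewrite leq_addl.
by apply/funext => v; rewrite linearD mul1r.
Qed.

Lemma schar_conv_word_deg (x : sym E) :
  exists n, wdeg_lt n (fun v => schar (conv_word v) x : K).
Proof.
elim/sym_ind: x => [|w x [n hn]|k x y [n hn] [p hp]].
- exists 1%N => b v; rewrite /wdiff.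
  by rewrite (rmorph1 (schar (conv_word (b :: v)))) (rmorph1 (schar (conv_word v))) subrr.
- have [p hp] := conv_word_deg w; exists (p + n)%N.
  have := wdeg_lt_mul hp hn; congr wdeg_lt; apply/funext => v.
  by rewrite (rmorphM (schar (conv_word v))); congr (_ * _); exact/esym/sym_lift_in.
- exists (n + p)%N.
  rewrite (_ : (fun v => _) =
    fun v => k * schar (conv_word v) x + schar (conv_word v) y).
    apply: wdeg_lt_lin; first by apply: wdeg_lt_le hn; rewrite leq_addr.
    by apply: wdeg_lt_le hp; rewrite leq_addl.
  by apply/funext => v; exact: (linearP (schar (conv_word v))).
Qed.

End FiniteDegree.

(** * Convolution of characters and of their pointwise limits *)

Section CharacterTensor.
Variables (K : fieldType) (W1 W2 : lmodType K) (f : dual W1) (g : dual W2).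

Lemma tdual_schar_mul (x y : tprod (sym W1) (sym W2)) :
  tdual (schar f) (schar g) (x * y) =
  (tdual (schar f) (schar g) x : K) * tdual (schar f) (schar g) y.
Proof.
elim/tprod_ind: x y => [y|a b x IHx y]; first by rewrite mul0r linear0 mul0r.
rewrite mulrDl !linearD IHx [RHS]mulrDl; congr (_ + _).
elim/tprod_ind: y => [|a' b' y IHy]; first by rewrite mulr0 linear0 mulr0.
rewrite mulrDr !linearD IHy [RHS]mulrDr; congr (_ + _).
have tp u v : tdual (schar f) (schar g) (pure u v) = (schar f u : K) * schar g v.
  exact: tprod_lift_pure.
rewrite pureM !tp.
rewrite (rmorphM (schar f)) (rmorphM (schar g)); exact: mulrACA.
Qed.

Lemma tdual_schar1 : tdual (schar f) (schar g) 1 = 1 :> K.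
Proof.
by rewrite [LHS]tprod_lift_pure (rmorph1 (schar f)) (rmorph1 (schar g)) mulr1.
Qed.
End CharacterTensor.

Section Convolution.
Variables (K : fieldType) (d m : nat) (op : uprod K d m).
Variable V : lmodType K.
Notation D := (tens_copies m V).
Notation E := (Espace d m V).
Notation Delta := (copies_delta m V).
Notation eps := (scounit E).
Local Notation "A '**' B" := (sconv op A B) (at level 40, left associativity).
Implicit Types (A B C : dual (sym E)) (x y z : sym E).

(** Sweedler notation: a chosen list of pure tensors for the coproduct, which makes every
    convolution a finite sum by definition. *)
Definition cop (x : sym E) : seq (sym E * sym E) := repr (scoprod op V x).

Lemma sconvE A B x : (A ** B) x = \sum_(p <- cop x) (A p.1 : K) * B p.2.
Proof. by []. Qed.

(** Both sides are multiplicative, since the coproduct is a homomorphism and a tensor product of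
    characters is a character. On generators this is the defining property of [sigma]. *)
Lemma schar_conv (ex : exists s, is_sigma op (A1 := D) (A2 := D) s)
  (phi psi : dual E) : schar phi ** schar psi = schar (conv op phi psi).
Proof.
apply: dual_ext; have sg : is_sigma op (sigma op D D).
  rewrite /sigma; case: pselect => // ex'; exact: (projT2 (cid ex')).
elim/sym_ind => [|w x IH|k x y IHx IHy].
- rewrite [LHS](congr1 (tdual _ _) (rmorph1 (scoprod op V))) tdual_schar1.
  exact/esym/(rmorph1 (schar _)).
- rewrite [LHS](congr1 (tdual _ _) (rmorphM (scoprod op V) _ _)) tdual_schar_mul.
  rewrite [RHS](rmorphM (schar _)); congr (_ * _); last exact: IH.
  rewrite [RHS]sym_lift_in [X in tdual _ _ X]sym_lift_in.
  exact/esym/(sg phi psi).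
- by rewrite !linearP IHx IHy.
Qed.

Hypothesis op_uau : uau op.
Hypothesis sigma_ex : exists s, is_sigma op (A1 := D) (A2 := D) s.

(** Linear functionals that are continuous for the topology of eventual equality at each point;
    identities between them pass to limits. *)
Definition fin_supp (L : dual (sym E) -> K) : Prop :=
  exists l : seq (K * sym E), forall A, L A = \sum_(p <- l) p.1 * A p.2.

Lemma fin_supp_ev x : fin_supp (fun A => A x).
Proof. by exists [:: (1, x)] => A; rewrite big_seq1 mul1r. Qed.

Lemma fin_supp_sum (I : Type) (s : seq I) (c : I -> K) L :
  (forall i, fin_supp (L i)) -> fin_supp (fun A => \sum_(i <- s) c i * L i A).
Proof.
move=> /choice[l hl].
exists [seq (c i * p.1, p.2) | i <- s, p <- l i] => A.
rewrite big_allpairs_dep; apply: eq_bigr => i _.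
by rewrite hl mulr_sumr; apply: eq_bigr => p _; rewrite mulrA.
Qed.

Lemma fin_supp_sconv (L : sym E -> dual (sym E) -> K) B x :
  (forall y, fin_supp (L y)) ->
  fin_supp (fun A => \sum_(p <- cop x) L p.1 A * B p.2).
Proof.
move=> hL; have [l hl] := @fin_supp_sum _ (cop x) (fun p => B p.2) (fun p => L p.1)
  (fun p => hL p.1).
by exists l => A; rewrite -hl; apply: eq_bigr => p _; rewrite mulrC.
Qed.

Lemma fin_supp_sconvr (L : sym E -> dual (sym E) -> K) B x :
  (forall y, fin_supp (L y)) ->
  fin_supp (fun A => \sum_(p <- cop x) (B p.1 : K) * L p.2 A).
Proof. by move=> hL; apply: fin_supp_sum => p. Qed.

(* [A] is a limit of linear combinations of the family [F], in the topology of
   eventual equality at each point. *)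
Definition approx (T : Type) (F : T -> dual (sym E)) A : Prop :=
  forall pts : seq (sym E), exists s : seq (K * T),
    forall z, z \in pts -> A z = \sum_(p <- s) p.1 * F p.2 z.

Section Approx.
Variables (T : Type) (F : T -> dual (sym E)).

Lemma approx_in t : approx F (F t).
Proof. by move=> pts; exists [:: (1, t)] => z _; rewrite big_seq1 mul1r. Qed.

Lemma approx_eq (L R : dual (sym E) -> K) A : fin_supp L -> fin_supp R ->
  (forall t, L (F t) = R (F t)) -> approx F A -> L A = R A.
Proof.
move=> [l hL] [r hR] LR appA.
(* The points are those at which [L] and [R] evaluate; there [A] is exactly a finite combination of
   the family. *)
have [s hs] := appA ([seq p.2 | p <- l] ++ [seq p.2 | p <- r]).
have ex (q : seq (K * sym E)) : {subset q <= l ++ r} ->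
  \sum_(p <- q) p.1 * A p.2 = \sum_(t <- s) t.1 * \sum_(p <- q) p.1 * F t.2 p.2.
  move=> qlr; under [RHS]eq_bigr => t _ do rewrite mulr_sumr.
  rewrite exchange_big big_seq [RHS]big_seq; apply: eq_bigr => p /qlr pq.
  rewrite hs; last by rewrite -map_cat; exact: map_f.
  by rewrite mulr_sumr; apply: eq_bigr => t _; rewrite mulrCA.
rewrite hL hR !ex; first by apply: eq_bigr => t _; rewrite -hL -hR LR.
  by move=> p; rewrite mem_cat orbC => ->.
by move=> p; rewrite mem_cat => ->.
Qed.

Lemma approx_lin k A B : approx F A -> approx F B -> approx F (k \*: A \+ B).
Proof.
move=> hA hB pts; have [s hs] := hA pts; have [t ht] := hB pts.
exists ([seq (k * p.1, p.2) | p <- s] ++ t) => z zp /=.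
rewrite hs // ht // big_cat big_map scaler_sumr; congr (_ + _).
by apply: eq_bigr => p _; exact: mulrA.
Qed.

Lemma approx_trans (T' : Type) (G : T' -> dual (sym E)) A :
  approx G A -> (forall t, approx F (G t)) -> approx F A.
Proof.
move=> hA hG pts; have [s hs] := hA pts.
have /choice[l hl] := fun t => hG t pts.
exists [seq (p.1 * q.1, q.2) | p <- s, q <- l p.2] => z zp.
rewrite hs // big_allpairs_dep; apply: eq_bigr => p _.
by rewrite (hl p.2) // mulr_sumr; apply: eq_bigr => q _; rewrite mulrA.
Qed.

(** At a given point a convolution sees its factors only at the tensor components of the coproduct,
    so it suffices to approximate [A] and [B] there. *)
Lemma approx_mul (T1 T2 : Type) (G : T1 -> dual (sym E)) (H : T2 -> dual (sym E)) A B :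
  approx G A -> approx H B -> (forall a b, exists t, G a ** H b = F t) ->
  approx F (A ** B).
Proof.
move=> hA hB GH pts.
have [s hs] := hA (flatten [seq [seq p.1 | p <- cop z] | z <- pts]).
have [t ht] := hB (flatten [seq [seq p.2 | p <- cop z] | z <- pts]).
have /choice[c hc] : forall ab : T1 * T2, exists t, G ab.1 ** H ab.2 = F t.
  by move=> [a b]; exact: GH.
exists [seq (p.1 * q.1, c (p.2, q.2)) | p <- s, q <- t] => z zp.
rewrite big_allpairs_dep; under eq_bigr => p _ do
  under eq_bigr => q _ do rewrite -(hc (p.2, q.2)) sconvE mulr_sumr.
under eq_bigr => p _ do rewrite exchange_big.
rewrite exchange_big sconvE big_seq [RHS]big_seq; apply: eq_bigr => r rz.
rewrite hs; last by apply/flatten_mapP; exists z => //; exact: map_f.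
rewrite ht; last by apply/flatten_mapP; exists z => //; exact: map_f.
rewrite mulr_suml; apply: eq_bigr => p _; rewrite mulr_sumr.
by apply: eq_bigr => q _ /=; rewrite mulrACA.
Qed.
End Approx.

Definition char_limit A : Prop := approx (@schar K E) A.

Lemma char_limit_schar phi : char_limit (schar phi).
Proof. exact: approx_in. Qed.

Lemma char_limit_eps : char_limit eps.
Proof. exact: approx_in. Qed.

Lemma char_limit_sconv A B : char_limit A -> char_limit B -> char_limit (A ** B).
Proof.
move=> hA hB; apply: (approx_mul hA hB) => phi psi.
by exists (conv op phi psi); exact: schar_conv.
Qed.

Lemma sconv1l A : char_limit A -> eps ** A = A.
Proof.
move=> hA; apply: dual_ext => x; move: hA.
apply: (approx_eq (L := fun A => (eps ** A) x) (R := fun A => A x)).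
- apply: (@fin_supp_sconvr (fun y A => A y)) => y; exact: fin_supp_ev.
- exact: fin_supp_ev.
- by move=> phi; rewrite /scounit schar_conv // conv0l.
Qed.

Lemma sconv1r A : char_limit A -> A ** eps = A.
Proof.
move=> hA; apply: dual_ext => x; move: hA.
apply: (approx_eq (L := fun A => (A ** eps) x) (R := fun A => A x)).
- apply: (@fin_supp_sconv (fun y A => A y)) => y; exact: fin_supp_ev.
- exact: fin_supp_ev.
- by move=> phi; rewrite /scounit schar_conv // conv0r.
Qed.

(** Both sides are continuous in each argument, so the arguments are replaced by characters one
    after another; for characters this is [convA]. *)
Lemma sconvA A B C : char_limit A -> char_limit B -> char_limit C ->
  A ** (B ** C) = A ** B ** C.
Proof.
move=> hA hB hC; apply: dual_ext => x; move: hA.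
apply: (approx_eq (L := fun A => (A ** (B ** C)) x) (R := fun A => (A ** B ** C) x)).
- apply: (@fin_supp_sconv (fun y A => A y)) => y; exact: fin_supp_ev.
- apply: (@fin_supp_sconv (fun y A => (A ** B) y)) => y.
  apply: (@fin_supp_sconv (fun z A => A z)) => z; exact: fin_supp_ev.
move=> phi; move: hB; set A' := schar phi.
apply: (approx_eq (L := fun B => (A' ** (B ** C)) x) (R := fun B => (A' ** B ** C) x)).
- apply: (@fin_supp_sconvr (fun y B => (B ** C) y)) => y.
  apply: (@fin_supp_sconv (fun z A => A z)) => z; exact: fin_supp_ev.
- apply: (@fin_supp_sconv (fun y B => (A' ** B) y)) => y.
  apply: (@fin_supp_sconvr (fun z A => A z)) => z; exact: fin_supp_ev.
move=> psi; move: hC; set B' := schar psi.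
apply: (approx_eq (L := fun C => (A' ** (B' ** C)) x) (R := fun C => (A' ** B' ** C) x)).
- apply: (@fin_supp_sconvr (fun y C => (B' ** C) y)) => y.
  apply: (@fin_supp_sconvr (fun z A => A z)) => z; exact: fin_supp_ev.
- apply: (@fin_supp_sconvr (fun z A => A z)) => y; exact: fin_supp_ev.
by move=> chi; rewrite !schar_conv // convA.
Qed.

End Convolution.

(** * Pointwise finite sums and the functional [D(psi)] *)

Lemma sum_trunc (U : nmodType) n p (G : nat -> U) : (n <= p)%N ->
  (forall j, (n <= j)%N -> G j = 0) -> \sum_(j < p) G j = \sum_(j < n) G j.
Proof.
move=> /subnKC <- G0; elim: (p - n)%N => [|k IH]; first by rewrite addn0.
by rewrite addnS big_ord_recr /= IH G0 ?addr0 // leq_addr.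
Qed.

Section PointwiseFiniteSums.
Variables (K : fieldType) (W : lmodType K).

(** A list [r y] is required at all points, because [pfsum] is zero by convention unless the family
    is finite everywhere. *)
Lemma pfsum_seq (I : choiceType) (F : I -> dual W) (r : W -> seq I) x :
  (forall y i, F i y != 0 -> i \in r y) -> uniq (r x) ->
  pfsum F x = \sum_(i <- r x) F i x.
Proof.
move=> hr ur; rewrite /pfsum; case: pselect => [fin|[]]; last first.
  move=> y; apply: (@sub_finite_set _ _ [set` r y]); last exact: finite_seq.
  by move=> i /= /hr.
apply: etrans (_ : \sum_(i \in [set: I]) (F i x : K^o) = _) _ => //.
rewrite (@fsbigE _ _ _ _ _ (r x)) //=.
  by apply: eq_bigl => i; rewrite in_setT.
by move=> i _ ir; apply/eqP; apply: contraNT ir => /hr.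
Qed.

Lemma pfsum_nat (F : nat -> dual W) x n :
  (forall y, exists n, forall i, (n <= i)%N -> F i y = 0) ->
  (forall i, (n <= i)%N -> F i x = 0) ->
  pfsum F x = \sum_(i < n) F i x.
Proof.
move=> /choice[N hN] hn.
(* The prescribed bound replaces the chosen one at [x], so that the sum has exactly [n] terms. *)
have [r hr] : exists r : W -> nat, r x = n /\ forall y i, (r y <= i)%N -> F i y = 0.
  exists (fun y => if y == x then n else N y); rewrite eqxx; split=> // y i.
  by case: eqP => [-> /hn|_ /hN].
rewrite (pfsum_seq (r := fun y => iota 0 (r y))) ?iota_uniq //.
  by rewrite hr.1 -[X in iota 0 X]subn0 -/(index_iota 0 n) big_mkord.
move=> y i; rewrite mem_iota /= add0n; apply: contraNT; rewrite -leqNgt.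
by move=> /hr.2 ->.
Qed.
End PointwiseFiniteSums.

Section Delta.
Variables (K : fieldType) (W : lmodType K) (psi : dual W).

Lemma sdelta_poly_inM w x :
  sdelta_poly psi (sym_in W w * x) = (psi w : K) *: 'X * sdelta_poly psi x.
Proof.
apply: etrans (rmorphM (sdelta_poly psi) _ _) _; congr (_ * _).
exact: sym_lift_in.
Qed.

Lemma sdelta_poly_coef0 x : (sdelta_poly psi x)`_0 = scounit W x.
Proof.
elim/sym_ind: x => [|w x _|k x y IHx IHy].
- by rewrite (congr1 (fun p : {poly K} => p`_0) (rmorph1 (sdelta_poly psi))) coef1
     (rmorph1 (scounit W)).
- rewrite sdelta_poly_inM -scalerAl coefZ coefXM mulr0.
  apply: esym; apply: etrans (rmorphM (scounit W) _ _) _.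
  have e : scounit W (sym_in W w) = 0 by exact: sym_lift_in.
  exact: etrans (congr1 (fun c : K => c * scounit W x) e) (mul0r _).
- rewrite (congr1 (fun p : {poly K} => p`_0) (linearP (sdelta_poly psi) k x y)).
  by rewrite coefD coefZ IHx IHy; exact/esym/(linearP (scounit W)).
Qed.

Lemma sdelta1 : sdelta psi 1 = 0.
Proof.
apply: etrans (congr1 (fun p : {poly K} => p`_1) (rmorph1 (sdelta_poly psi))) _.
by rewrite coef1.
Qed.

(** With the value 0 at 1 and linearity, this recursion determines [sdelta psi]; the logarithm of a
    character is recognised by it. *)
Lemma sdelta_inM w x : sdelta psi (sym_in W w * x) = (psi w : K) * scounit W x.
Proof.
apply: etrans (congr1 (fun p : {poly K} => p`_1) (sdelta_poly_inM w x)) _.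
by rewrite -scalerAl coefZ coefXM sdelta_poly_coef0.
Qed.
End Delta.

Lemma coefM1 (R : nzRingType) (p q : {poly R}) :
  (p * q)`_1 = p`_0 * q`_1 + p`_1 * q`_0.
Proof. by rewrite coefM big_ord_recl big_ord1. Qed.

(** * Binomial polynomials in characteristic zero *)

Section BinomialPolynomials.
Variable K : fieldType.
Hypothesis charK : forall n, n.+1%:R != 0 :> K.

Lemma natr_neq0 n : (0 < n)%N -> n%:R != 0 :> K.
Proof. by case: n. Qed.

Lemma natr_injective : injective (fun n : nat => n%:R : K).
Proof.
move=> i j; wlog le_ij : i j / (i <= j)%N => [h|].
  by case/orP: (leq_total i j) => [/h//|/h h' /esym/h'/esym].
move=> /eqP; rewrite -subr_eq0 -opprB oppr_eq0 -natrB //.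
rewrite -(subnKC le_ij) addKn; case: (j - i)%N => [|k]; first by rewrite addn0.
by rewrite (negPf (charK k)).
Qed.

Lemma poly_nat_eq (p q : {poly K}) : (forall k, p.[k%:R] = q.[k%:R]) -> p = q.
Proof.
move=> pq; apply/eqP; rewrite -subr_eq0; apply/eqP.
apply: (@roots_geq_poly_eq0 _ _ [seq k%:R | k <- iota 0 (size (p - q))]).
- by apply/allP => _ /mapP[k _ ->]; rewrite rootE hornerD hornerN pq subrr.
- by rewrite map_inj_uniq ?iota_uniq //; exact: natr_injective.
- by rewrite size_map size_iota.
Qed.

Definition binpoly (j : nat) : {poly K} :=
  j`!%:R^-1 *: \prod_(i < j) ('X - i%:R%:P).

Lemma binpolyE j k : (binpoly j).[k%:R] = 'C(k, j)%:R.
Proof.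
have e : (\prod_(i < j) ('X - i%:R%:P) : {poly K}).[k%:R] = (k ^_ j)%:R.
  elim: j => [|j IH]; first by rewrite big_ord0 hornerC.
  rewrite big_ord_recr /= hornerM IH hornerXsubC ffactnSr natrM.
  (* [k - j] is truncated; for [k < j] the falling factorial in front of it vanishes already. *)
  have [le_jk|lt_kj] := leqP j k; first by rewrite natrB.
  by rewrite ffact_small // !mul0r.
have jn0 : j`!%:R != 0 :> K by rewrite natr_neq0 // fact_gt0.
by rewrite hornerZ e -bin_ffact natrM mulrC mulfK.
Qed.

(** Without its factor ['X] the product has the value [(-1)^j j!] at 0; division by [(j+1)!] leaves
    the coefficient of the logarithm series. *)
Lemma binpoly_coef1 j : (binpoly j.+1)`_1 = ln_coef K j.+1.
Proof.
rewrite coefZ big_ord_recl subr0 coefXM /=.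
have -> : (\prod_(i < j) ('X - (bump 0 i)%:R%:P) : {poly K})`_0 = (-1) ^+ j * j`!%:R.
  rewrite -horner_coef0; elim: j => [|j IH].
    by rewrite big_ord0 hornerC mulr1.
  rewrite big_ord_recr /= hornerM IH hornerXsubC factS natrM /bump /= add1n sub0r.
  by rewrite exprSr; ring.
rewrite /ln_coef factS natrM invfM !exprSr !mulrN1 opprK mulrCA.
by rewrite -mulrA mulVf ?mulr1 // natr_neq0 // fact_gt0.
Qed.
End BinomialPolynomials.

(** * Convolution powers as polynomials; logarithm and exponential of a character *)

Section Words.
Variables (K : fieldType) (d m : nat) (op : uprod K d m).
Variable V : lmodType K.
Notation D := (tens_copies m V).
Notation E := (Espace d m V).
Notation eps := (scounit E).
Local Notation "A '**' B" := (sconv op A B) (at level 40, left associativity).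
Local Notation chr f := (schar f : dual (sym E)).
Implicit Types (A B C : dual (sym E)) (x y z : sym E).
Hypothesis op_uau : uau op.
Hypothesis sigma_ex : exists s, is_sigma op (A1 := D) (A2 := D) s.

Definition wordc (X : bool -> dual (sym E)) (w : seq bool) : dual (sym E) :=
  foldr (fun b => sconv op (X b)) eps w.

Lemma wordc_limit X w : (forall b, char_limit (X b)) -> char_limit (wordc X w).
Proof.
move=> hX; elim: w => [|b w IH] /=; first exact: char_limit_eps.
exact: char_limit_sconv.
Qed.

Lemma wordc_cat X w w' : (forall b, char_limit (X b)) ->
  wordc X (w ++ w') = wordc X w ** wordc X w'.
Proof.
move=> hX; elim: w => [|b w IH] /=.
  by rewrite (sconv1l op_uau sigma_ex) //; exact: wordc_limit.
by rewrite IH (sconvA op_uau sigma_ex) //; exact: wordc_limit.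
Qed.

Lemma sconv_exp_wordc A X b n : X b = A -> sconv_exp op A n = wordc X (nseq n b).
Proof. by move=> e; elim: n => [|n IH] //=; rewrite -IH e. Qed.

Definition vanishing X : Prop :=
  forall x, exists n, forall w, (n <= size w)%N -> wordc X w x = 0.

Definition char_dev (phi1 phi2 : dual E) (b : bool) : dual (sym E) :=
  schar (phi_at phi1 phi2 b) \- eps.

Lemma char_dev_limit phi1 phi2 b : char_limit (char_dev phi1 phi2 b).
Proof.
have -> : char_dev phi1 phi2 b = (-1 \*: eps \+ schar (phi_at phi1 phi2 b)).
  by apply: dual_ext => z /=; rewrite scaleN1r addrC.
by apply: approx_lin; [exact: char_limit_eps|exact: char_limit_schar].
Qed.

(** This identifies convolution by a deviation from the counit with the word difference [wdiff]. *)
Lemma sconv_char_dev phi1 phi2 b psi x :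
  (char_dev phi1 phi2 b ** schar psi) x =
  chr (conv op (phi_at phi1 phi2 b) psi) x - chr psi x.
Proof.
have e1 : chr (conv op (phi_at phi1 phi2 b) psi) x =
    (schar (phi_at phi1 phi2 b) ** schar psi) x.
  by rewrite (schar_conv sigma_ex).
have e2 : chr psi x = (eps ** schar psi) x.
  by rewrite (sconv1l op_uau sigma_ex) //; exact: char_limit_schar.
by rewrite e1 e2 !sconvE -sumrB; apply: eq_bigr => p _; rewrite /= mulrBl.
Qed.

Lemma sconv_linr A B C B' x : (forall z, B' z = B z - C z) ->
  (A ** B') x = (A ** B) x - (A ** C) x.
Proof.
move=> h; rewrite !sconvE -sumrB; apply: eq_bigr => p _.
by rewrite h mulrBr.
Qed.

Lemma char_dev_vanishing phi1 phi2 : vanishing (char_dev phi1 phi2).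
Proof.
move=> x; have [n hn] := schar_conv_word_deg op_uau phi1 phi2 x.
pose U v w := foldr (fun b => sconv op (char_dev phi1 phi2 b))
  (schar (conv_word op phi1 phi2 v)) w.
(* The last letter of [w] acts first, on the character of [v], and so becomes a new first letter of
   [v]. *)
have c w b v z : U v (rcons w b) z = U (b :: v) w z - U v w z.
  elim: w z => [|b' w IH] z; first exact: sconv_char_dev.
  exact: sconv_linr.
have e w v : wdiffs w (fun v => schar (conv_word op phi1 phi2 v) x) v = U v w x.
  elim/last_ind: w v => [|w b IH] v //.
  by rewrite c -!IH /wdiffs -cats1 foldl_cat.
exists n => w le_n; exact: etrans (esym (e w [::])) (wdiffs_deg [::] hn le_n).
Qed.

Definition convn phi (k : nat) : dual E := iter k (conv op phi) (zero_dual d m V).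

Hypothesis charK : forall n, n.+1%:R != 0 :> K.

Section Newton.
Variable phi : dual E.
Notation dev := (char_dev phi phi false).

Lemma dev_exp_vanish x : exists n, forall i, (n <= i)%N -> sconv_exp op dev i x = 0.
Proof.
have [n hn] := char_dev_vanishing phi phi x; exists n => i le_n.
rewrite (@sconv_exp_wordc _ (char_dev phi phi) false) //.
by apply: hn; rewrite size_nseq.
Qed.

(** Binomial theorem for [S(phi) = eps + dev]. The number of terms is left free above [k], because
    Pascal's rule combines sums of different lengths. *)
Lemma newton_bound n k x : (k < n)%N ->
  chr (convn phi k) x = \sum_(j < n) 'C(k, j)%:R * sconv_exp op dev j x.
Proof.
elim: k n x => [|k IH] [|n] x // lt_kn.
  rewrite big_ord_recl bin0 mul1r big1 ?addr0 // => i _.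
  by rewrite bin_small // mul0r.
have := sconv_char_dev phi phi false (convn phi k) x.
rewrite -[conv _ _ _]/(convn phi k.+1) => /esym/(canRL (subrK _)) ->.
rewrite sconvE; under eq_bigr => p _ do rewrite (IH n) // mulr_sumr.
rewrite exchange_big big_ord_recl bin0 mul1r.
rewrite (IH n.+1) 1?ltnW // big_ord_recl bin0 mul1r addrCA; congr (_ + _).
rewrite -big_split; apply: eq_bigr => j _.
rewrite binS natrD mulrDl addrC; congr (_ + _).
rewrite [sconv_exp _ _ _]/= sconvE mulr_sumr; apply: eq_bigr => p _.
by rewrite mulrCA.
Qed.

(* The binomial polynomial of degree [j] has derivative [(-1)^(j+1) / j] at [0],
   which is the coefficient of the logarithm series. *)
Lemma newton_poly x : exists Q : {poly K},
  (forall k, Q.[k%:R] = schar (convn phi k) x) /\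
  Q`_1 = ln_star op (schar phi) x.
Proof.
have [n hn] := dev_exp_vanish x.
(* The binomial for [j = 0] is constant; the other [n] terms match those of the logarithm. *)
exists (\sum_(j < n.+1) sconv_exp op dev j x *: binpoly K j); split=> [k|].
  rewrite horner_sum; apply: etrans (_ : _ = chr (convn phi k) x) _ => //.
  (* [newton_bound] asks for more than [k] terms; those from [n.+1] on vanish. *)
  rewrite (@newton_bound (n.+1 + k.+1)) ?leq_addl //.
  rewrite (sum_trunc (leq_addr k.+1 n.+1)
    (G := fun j => 'C(k, j)%:R * sconv_exp op dev j x)); last first.
    by move=> j /ltnW/hn ->; rewrite mulr0.
  by apply: eq_bigr => j _; rewrite hornerZ binpolyE // mulrC.
rewrite /ln_star (pfsum_nat (n := n)).
- rewrite coef_sum big_ord_recl coefZ /binpoly big_ord0 coefZ coef1 !mulr0 add0r.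
  by apply: eq_bigr => j _; rewrite coefZ binpoly_coef1 // mulrC.
- move=> y; have [p hp] := dev_exp_vanish y; exists p => i le_i.
  apply: etrans (_ : ln_coef K i.+1 * sconv_exp op dev i.+1 y = 0) => //.
  by rewrite hp ?mulr0 // ltnW.
- move=> i le_i.
  apply: etrans (_ : ln_coef K i.+1 * sconv_exp op dev i.+1 x = 0) => //.
  by rewrite hn ?mulr0 // ltnW.
Qed.

Definition newton_of : sym E -> {poly K} := projT1 (choice newton_poly).

Lemma newton_ofE x k : (newton_of x).[k%:R] = chr (convn phi k) x.
Proof. exact: (projT2 (choice newton_poly) x).1. Qed.

Lemma newton_of1 x : (newton_of x)`_1 = ln_star op (schar phi) x.
Proof. exact: (projT2 (choice newton_poly) x).2. Qed.

Lemma newton_of0 x : (newton_of x)`_0 = eps x.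
Proof. by rewrite -horner_coef0 -[0](mulr0n 1) newton_ofE. Qed.

Lemma newton_ofM x y : newton_of (x * y) = newton_of x * newton_of y.
Proof.
apply: (poly_nat_eq charK) => k; rewrite hornerM !newton_ofE.
exact: (rmorphM (schar (convn phi k))).
Qed.

Lemma newton_of_one : newton_of 1 = 1.
Proof.
apply: (poly_nat_eq charK) => k; rewrite newton_ofE hornerC.
exact: (rmorph1 (schar (convn phi k))).
Qed.

(* As the derivative at [0] of the multiplicative functionals [schar (convn phi k)]
   the logarithm is a derivation along the counit. *)
Lemma ln_star_schar : ln_star op (schar phi) = sdelta (ln_op op phi).
Proof.
apply: dual_ext; elim/sym_ind => [|w x IH|k x y IHx IHy].
- rewrite -newton_of1 newton_of_one coef1.
  exact/esym/sdelta1.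
- rewrite -newton_of1 newton_ofM coefM1 !newton_of0.
  have eps_in : eps (sym_in E w) = 0 by exact: sym_lift_in.
  rewrite eps_in mul0r add0r.
  by rewrite newton_of1; exact/esym/sdelta_inM.
- by rewrite !linearP IHx IHy.
Qed.

(** The identity S(phi^(k+l)) = S(phi^k) * S(phi^l) is polynomial in [k]; its derivative at [k = 0]
    brings in the logarithm. *)
Lemma newton_of_shift x l :
  (newton_of x)^`().[l%:R] =
  \sum_(p <- cop op x) (ln_star op (schar phi) p.1 : K) * (newton_of p.2).[l%:R].
Proof.
have e : newton_of x \Po ('X + l%:R%:P) =
    \sum_(p <- cop op x) (newton_of p.2).[l%:R] *: newton_of p.1.
  apply: (poly_nat_eq charK) => k; rewrite horner_comp hornerD hornerX hornerC.
  rewrite -natrD newton_ofE horner_sum.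
  have -> : chr (convn phi (k + l)) = chr (convn phi k) ** chr (convn phi l).
    rewrite (schar_conv sigma_ex); congr (chr _).
    elim: k => [|k IH]; first by rewrite [convn phi 0]/= conv0l.
    by rewrite addSn [convn phi _.+1]/= -/(convn phi _) IH convA.
  rewrite sconvE; apply: eq_bigr => p _.
  by rewrite hornerZ !newton_ofE mulrC.
have := congr1 (fun q : {poly K} => q^`().[0]) e.
rewrite deriv_comp derivD derivX derivC addr0 mulr1 horner_comp hornerD hornerX.
rewrite hornerC add0r => ->.
rewrite horner_coef0 coef_deriv mulr1n coef_sum; apply: eq_bigr => p _.
by rewrite coefZ newton_of1 mulrC.
Qed.

(** The shift formula holds at all naturals [l], so differentiating [newton_of] amounts to
    convolving with the logarithm from the left; the [n]-th derivative at 0 gives the factorial. *)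
Lemma sconv_exp_ln n x :
  sconv_exp op (ln_star op (schar phi)) n x = n`!%:R * (newton_of x)`_n.
Proof.
elim: n x => [|n IH] x; first by rewrite newton_of0 mul1r.
have e : (newton_of x)^`() =
    \sum_(p <- cop op x) (ln_star op (schar phi) p.1 : K) *: newton_of p.2.
  apply: (poly_nat_eq charK) => l; rewrite newton_of_shift horner_sum.
  by apply: eq_bigr => p _; rewrite hornerZ.
rewrite factS mulnC natrM -mulrA.
have -> : n.+1%:R * (newton_of x)`_n.+1 = ((newton_of x)^`())`_n.
  by rewrite coef_deriv mulr_natl.
rewrite e coef_sum mulr_sumr [LHS]sconvE; apply: eq_bigr => p _.
by rewrite IH coefZ mulrCA.
Qed.

Lemma schar_exp n x : (size (newton_of x) <= n)%N ->
  chr phi x = \sum_(i < n) i`!%:R^-1 * sconv_exp op (ln_star op (schar phi)) i x.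
Proof.
move=> le_n.
transitivity (chr (convn phi 1) x); first by rewrite [convn phi 1]/= conv0r.
rewrite -newton_ofE (horner_coef_wide _ le_n); apply: eq_bigr => i _.
by rewrite sconv_exp_ln mulKf ?expr1n ?mulr1 // natr_neq0 // fact_gt0.
Qed.
End Newton.

Variables phi1 phi2 : dual E.

Definition ln_at (b : bool) : dual (sym E) :=
  ln_star op (schar (phi_at phi1 phi2 b)).

(** Closed span of the long words in the deviations, in the role of the [n]-th power of an ideal. *)
Definition word_filt (n : nat) A : Prop :=
  approx (fun w : {w : seq bool | (n <= size w)%N} =>
    wordc (char_dev phi1 phi2) (sval w)) A.

Lemma dev_exp_wordc b n :
  sconv_exp op (char_dev phi1 phi2 b) n = wordc (char_dev phi1 phi2) (nseq n b).
Proof. exact: sconv_exp_wordc. Qed.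

(** At finitely many points the logarithm series can be cut off at a common length, and each of its
    terms is a multiple of a nonempty word. *)
Lemma ln_at_filt b : word_filt 1 (ln_at b).
Proof.
move=> pts; have /choice[N hN] := char_dev_vanishing phi1 phi2.
pose n := \max_(z <- pts) N z.
have sz l : (1 <= size (nseq l.+1 b))%N by rewrite size_nseq.
exists [seq (ln_coef K l.+1, exist _ (nseq l.+1 b) (sz l)) | l <- iota 0 n] => z zp.
have ev0 z' l : (N z' <= l)%N ->
    (ln_coef K l.+1 \*: sconv_exp op (char_dev phi1 phi2 b) l.+1 : dual _) z' = 0.
  move=> le_l; rewrite dev_exp_wordc.
  apply: etrans (_ : ln_coef K l.+1 * wordc (char_dev phi1 phi2) (nseq l.+1 b) z' = 0) => //.
  by rewrite hN ?mulr0 // size_nseq ltnW.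
rewrite /ln_at /ln_star (pfsum_nat (n := n)).
- rewrite big_map -[n in iota 0 n]subn0 -/(index_iota 0 n) big_mkord.
  by apply: eq_bigr => l _; rewrite -dev_exp_wordc.
- by move=> y; exists (N y) => l; exact: ev0.
- by move=> l le_l; apply: ev0; apply: leq_trans le_l; exact: leq_bigmax_seq.
Qed.

Lemma word_filt_limit n A : word_filt n A -> char_limit A.
Proof.
move=> hA; apply: approx_trans hA _ => w; apply: wordc_limit => b.
exact: char_dev_limit.
Qed.

Lemma ln_at_limit b : char_limit (ln_at b).
Proof. exact: word_filt_limit (ln_at_filt b). Qed.

(** The filtration is multiplicative: a word of length [p] in the logarithms is a limit of
    combinations of words of length at least [p] in the deviations, which vanish at [x] for large
    [p]. *)
Lemma ln_at_vanishing : vanishing ln_at.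
Proof.
have filt w : word_filt (size w) (wordc ln_at w).
  elim: w => [|b w IH].
    exact: (approx_in (fun w : {w : seq bool | (0 <= size w)%N} =>
      wordc (char_dev phi1 phi2) (sval w)) (exist _ [::] isT)).
  apply: (approx_mul (ln_at_filt b) IH) => -[u hu] [v hv].
  have huv : ((size w).+1 <= size (u ++ v))%N by rewrite size_cat -add1n leq_add.
  exists (exist _ (u ++ v) huv); rewrite /= wordc_cat // => c.
  exact: char_dev_limit.
move=> x; have [n hn] := char_dev_vanishing phi1 phi2 x; exists n => w le_n.
have [s ->] := filt w [:: x]; last by rewrite mem_head.
by apply: big1 => -[k [v hv]] _; rewrite hn ?mulr0 //; exact: leq_trans hv.
Qed.

End Words.

(** * Sums over words and formal series in two letters *)

Lemma sum_antidiagonal (U : nmodType) n (T : nat -> nat -> U) :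
  (forall a b, (n <= a + b)%N -> T a b = 0) ->
  \sum_(i < n) \sum_(j < n) T i j = \sum_(i < n) \sum_(k < i.+1) T k (i - k)%N.
Proof.
move=> T0.
(* The vanishing terms reduce the square to a triangle, which is regrouped by induction on its
   size. *)
have -> : \sum_(i < n) \sum_(j < n) T i j = \sum_(i < n) \sum_(j < n - i) T i j.
  apply: eq_bigr => i _; apply: (sum_trunc (leq_subr i n)) => j le_j.
  by apply: T0; rewrite -leq_subLR.
elim: (n) => [|p IH]; first by rewrite !big_ord0.
rewrite [RHS]big_ord_recr -IH [in RHS]big_ord_recr /= addrA.
rewrite [LHS]big_ord_recr /=; congr (_ + _); last first.
  by rewrite subnn subSnn big_ord1.
rewrite -big_split; apply: eq_bigr => i _.
by rewrite subSn ?big_ord_recr // ltnW.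
Qed.

Fixpoint words (n : nat) : seq (seq bool) :=
  if n is n'.+1 then map (cons false) (words n') ++ map (cons true) (words n')
  else [:: [::]].

Lemma mem_words n w : (w \in words n) = (size w == n).
Proof.
have cons_inj b : injective (cons b : seq bool -> _) by move=> u v [].
elim: n w => [|n IH] [|b w] //; first by rewrite mem_cat; apply/orP => -[] /mapP[].
rewrite mem_cat; case: b; rewrite (mem_map (@cons_inj _)) IH eqSS.
  by apply: orb_idl => /mapP[? _].
by apply: orb_idr => /mapP[? _].
Qed.

Lemma uniq_words n : uniq (words n).
Proof.
have cons_inj b : injective (cons b : seq bool -> _) by move=> u v [].
elim: n => //= n IH; rewrite cat_uniq !map_inj_uniq // IH andbT /=.
by apply/hasPn => _ /mapP[w _ ->]; apply/negP => /mapP[].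
Qed.

Lemma sum_words_cat (U : nmodType) i j (G : seq bool -> seq bool -> U) :
  \sum_(w <- words (i + j)) G (take i w) (drop i w) =
  \sum_(u <- words i) \sum_(v <- words j) G u v.
Proof.
elim: i G => [|i IH] G.
  rewrite big_seq1 add0n; apply: eq_bigr => w _; by rewrite take0 drop0.
rewrite addSn !big_cat !big_map.
by congr (_ + _); [rewrite -(IH (fun u => G (false :: u)))|
                   rewrite -(IH (fun u => G (true :: u)))].
Qed.

Lemma sum_words_all (U : nmodType) b n (F : seq bool -> U) :
  \sum_(w <- words n) (if all (pred1 b) w then F w else 0) = F (nseq n b).
Proof.
elim: n F => [|n IH] F; first by rewrite big_seq1.
have z : \sum_(w <- words n) (0 : U) = 0 by exact: big1_eq.
rewrite big_cat !big_map; have := IH (fun w => F (b :: w)).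
case: b {IH} => IH.
  exact: etrans (congr2 _ z IH) (add0r _).
exact: etrans (congr2 _ IH z) (addr0 _).
Qed.

Definition words_lt (n : nat) : seq (seq bool) := flatten [seq words i | i <- iota 0 n].

Lemma mem_words_lt n w : (w \in words_lt n) = (size w < n)%N.
Proof.
apply/flatten_mapP/idP => [ [i ] | lt_n].
  by rewrite mem_iota mem_words => /= lt_n /eqP ->.
by exists (size w); rewrite ?mem_iota ?mem_words.
Qed.

Lemma sum_words_lt (U : nmodType) n (F : seq bool -> U) :
  \sum_(w <- words_lt n) F w = \sum_(i < n) \sum_(w <- words i) F w.
Proof.
rewrite big_flatten big_map -[X in iota 0 X]subn0 -/(index_iota 0 n).
by rewrite big_mkord.
Qed.

Lemma uniq_words_lt n : uniq (words_lt n).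
Proof.
elim: n => // n IH; rewrite /words_lt -[n.+1]addn1 iotaD map_cat flatten_cat cat_uniq.
rewrite -/(words_lt n) IH /= cats0 add0n uniq_words andbT.
by apply/hasPn => w; rewrite mem_words mem_words_lt => /eqP ->; rewrite ltnn.
Qed.

Section Series.
Variable K : fieldType.
Implicit Types f g h : seq bool -> K.

(** Having no constant term, every factor [h] consumes at least one letter. *)
Lemma ncs_pow_small h l w : h [::] = 0 -> (size w < l)%N ->
  iter l (ncs_mul h) (@ncs_one K) w = 0.
Proof.
move=> h0; elim: l w => // l IH w; rewrite ltnS => le_l.
rewrite iterS /ncs_mul big1 // => -[[|i] /= lt_i] _; first by rewrite take0 h0 mul0r.
rewrite IH ?mulr0 // size_drop; case: (size w) lt_i le_l => // s _.
by apply: leq_ltn_trans; rewrite subSS leq_subr.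
Qed.

(** The definition cuts the logarithm at the length of [w]; a common cutoff [n] can be interchanged
    with sums over words. *)
Lemma ncs_ln_sum f w n : f [::] = 1 -> (size w <= n)%N ->
  ncs_ln f w = \sum_(l < n) ln_coef K l.+1 *
    iter l.+1 (ncs_mul (f \- @ncs_one K)) (@ncs_one K) w.
Proof.
move=> f1 le_n; rewrite /ncs_ln big_add1 /= big_mkord.
rewrite [RHS](@sum_trunc _ _ _ (fun l => ln_coef K l.+1 *
    iter l.+1 (ncs_mul (f \- @ncs_one K)) (@ncs_one K) w) le_n) //.
move=> l le_l; rewrite ncs_pow_small ?mulr0 //=.
by rewrite f1 /ncs_one eqxx subrr.
Qed.
End Series.

(** * Substitution of functionals in formal series *)

Section Evaluation.
Variables (K : fieldType) (d m : nat) (op : uprod K d m).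
Variable V : lmodType K.
Notation D := (tens_copies m V).
Notation E := (Espace d m V).
Notation eps := (scounit E).
Local Notation "A '**' B" := (sconv op A B) (at level 40, left associativity).
Local Notation chr f := (schar f : dual (sym E)).
Implicit Types (A B C : dual (sym E)) (x y z : sym E) (f g h : seq bool -> K).
Hypothesis op_uau : uau op.
Hypothesis sigma_ex : exists s, is_sigma op (A1 := D) (A2 := D) s.

Section Family.
Variable X : bool -> dual (sym E).
Hypothesis X_limit : forall b, char_limit (X b).
Hypothesis X_vanishing : vanishing op X.

Definition word_bound x n : Prop := forall w, (n <= size w)%N -> wordc op X w x = 0.

Definition nc_eval f : dual (sym E) :=
  pfsum (fun w : seq bool => f w \*: wordc op X w : dual _).

Lemma nc_evalE f x n : word_bound x n ->
  nc_eval f x = \sum_(i < n) \sum_(w <- words i) f w * wordc op X w x.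
Proof.
move=> hn; have /choice[N hN] := X_vanishing.
rewrite -(sum_words_lt n (fun w => f w * wordc op X w x)) /nc_eval.
have hr y w : (f w \*: wordc op X w : dual _) y != 0 ->
    w \in words_lt (if y == x then n else N y).
  rewrite mem_words_lt; apply: contraNT; rewrite -leqNgt => le_w; apply/eqP.
  apply: etrans (_ : f w * wordc op X w y = 0) => //.
  case: eqP le_w => [->|_] le_w; first by rewrite hn ?mulr0.
  by rewrite hN ?mulr0.
by rewrite (pfsum_seq hr) ?uniq_words_lt // eqxx.
Qed.

Lemma word_bound_le x n p : (n <= p)%N -> word_bound x n -> word_bound x p.
Proof. by move=> le_np hn w le_p; apply: hn; exact: leq_trans le_p. Qed.

Lemma word_bound_seq (s : seq (sym E)) : exists n, forall x, x \in s -> word_bound x n.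
Proof.
have /choice[N hN] := X_vanishing; exists (\max_(z <- s) N z) => x xs w le_w.
by apply: hN; apply: leq_trans le_w; exact: leq_bigmax_seq.
Qed.

Lemma nc_eval_one : nc_eval (@ncs_one K) = eps.
Proof.
apply: dual_ext => x; have [n hn] := X_vanishing x.
rewrite (nc_evalE _ (word_bound_le (leqnSn n) hn)) big_ord_recl big_seq1 mul1r.
rewrite big1 ?addr0 // => i _; rewrite big_seq big1 // => w.
by rewrite mem_words /ncs_one; case: w => // b w _; rewrite mul0r.
Qed.

Lemma nc_evalB f g x : nc_eval (f \- g) x = nc_eval f x - nc_eval g x.
Proof.
have [n hn] := X_vanishing x; rewrite !(nc_evalE _ hn) -sumrB.
apply: eq_bigr => i _; rewrite -sumrB; apply: eq_bigr => w _.
exact: mulrBl.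
Qed.

(** Pairs [(u, v)] are regrouped by the concatenated word. [T a b] collects the lengths [a] and [b]
    and vanishes for [a + b >= n], so the square from the product of two evaluations equals the
    triangle from the product series. *)
Lemma nc_evalM f g : nc_eval (ncs_mul f g) = nc_eval f ** nc_eval g.
Proof.
apply: dual_ext => x.
(* One bound for [x] and all tensor components of its coproduct. *)
have [n hn] := word_bound_seq
  (x :: [seq p.1 | p <- cop op x] ++ [seq p.2 | p <- cop op x]).
have hx : word_bound x n by apply: hn; rewrite mem_head.
have h1 p : p \in cop op x -> word_bound p.1 n.
  by move=> px; apply: hn; rewrite inE mem_cat map_f ?orbT.
have h2 p : p \in cop op x -> word_bound p.2 n.
  by move=> px; apply: hn; rewrite inE mem_cat (map_f snd) ?orbT.
pose T a b := \sum_(u <- words a) \sum_(v <- words b)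
  f u * g v * (wordc op X u ** wordc op X v) x.
have T0 a b : (n <= a + b)%N -> T a b = 0.
  move=> le_n; rewrite /T big_seq big1 // => u; rewrite mem_words => /eqP su.
  rewrite big_seq big1 // => v; rewrite mem_words => /eqP sv.
  by rewrite -wordc_cat // hx ?mulr0 // size_cat su sv.
transitivity (\sum_(i < n) \sum_(k < i.+1) T k (i - k)%N).
  rewrite (nc_evalE _ hx); apply: eq_bigr => i _.
  transitivity (\sum_(w <- words i) \sum_(k < i.+1)
     f (take k w) * g (drop k w) * (wordc op X (take k w) ** wordc op X (drop k w)) x).
    rewrite big_seq [RHS]big_seq; apply: eq_bigr => w; rewrite mem_words => /eqP sw.
    rewrite /ncs_mul sw mulr_suml; apply: eq_bigr => k _.
    by rewrite -wordc_cat // cat_take_drop.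
  rewrite exchange_big; apply: eq_bigr => k _.
  have {1}-> : nat_of_ord i = (k + (i - k))%N by rewrite subnKC // -ltnS.
  exact: (sum_words_cat k (i - k) (fun u v =>
    f u * g v * (wordc op X u ** wordc op X v) x)).
rewrite -sum_antidiagonal // sconvE.
transitivity (\sum_(p <- cop op x) \sum_(i < n) \sum_(j < n)
   \sum_(u <- words i) \sum_(v <- words j)
     f u * g v * ((wordc op X u p.1 : K) * wordc op X v p.2)).
  rewrite [RHS]exchange_big; apply: eq_bigr => i _.
  rewrite [RHS]exchange_big; apply: eq_bigr => j _.
  rewrite [RHS]exchange_big; apply: eq_bigr => u _.
  rewrite [RHS]exchange_big; apply: eq_bigr => v _.
  by rewrite sconvE mulr_sumr.
rewrite big_seq [RHS]big_seq; apply: eq_bigr => p px.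
rewrite (nc_evalE _ (h1 _ px)) (nc_evalE _ (h2 _ px)) mulr_suml.
apply: eq_bigr => i _; rewrite mulr_sumr; apply: eq_bigr => j _.
rewrite mulr_suml; apply: eq_bigr => u _; rewrite mulr_sumr; apply: eq_bigr => v _.
by rewrite mulrACA.
Qed.

Lemma nc_eval_pow f l :
  sconv_exp op (nc_eval f) l = nc_eval (iter l (ncs_mul f) (@ncs_one K)).
Proof.
elim: l => [|l IH]; first exact/esym/nc_eval_one.
by rewrite iterS nc_evalM -IH.
Qed.

(** Substitution is multiplicative, so powers of [f - 1] go to powers of the deviation from the
    counit. Since high powers vanish on short words, both sums can be cut at the same [n]. *)
Lemma nc_eval_ln f : f [::] = 1 -> ln_star op (nc_eval f) = nc_eval (ncs_ln f).
Proof.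
move=> f1; pose h := f \- @ncs_one K.
have h0 : h [::] = 0 by rewrite /h /= f1 /ncs_one eqxx subrr.
have e l : sconv_exp op (nc_eval f \- eps) l = nc_eval (iter l (ncs_mul h) (@ncs_one K)).
  rewrite -nc_eval_pow; congr (sconv_exp op _ l).
  by apply: dual_ext => x; rewrite nc_evalB nc_eval_one.
apply: dual_ext => x; have [n hn] := X_vanishing x.
have ev0 y p l : word_bound y p -> (p <= l)%N ->
    (ln_coef K l.+1 \*: sconv_exp op (nc_eval f \- eps) l.+1 : dual _) y = 0.
  move=> hp le_l.
  apply: etrans (_ : ln_coef K l.+1 * sconv_exp op (nc_eval f \- eps) l.+1 y = 0) => //.
  rewrite e (nc_evalE _ hp) big1 ?mulr0 // => i _; rewrite big_seq big1 // => w.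
  rewrite mem_words => /eqP sw; rewrite ncs_pow_small ?mul0r // sw ltnS ltnW //.
  exact: leq_trans le_l.
rewrite /ln_star (pfsum_nat (n := n)).
- rewrite (nc_evalE _ hn).
  transitivity (\sum_(l < n) \sum_(i < n) \sum_(w <- words i)
     ln_coef K l.+1 * (iter l.+1 (ncs_mul h) (@ncs_one K) w * wordc op X w x)).
    apply: eq_bigr => l _.
    apply: etrans (_ : ln_coef K l.+1 * sconv_exp op (nc_eval f \- eps) l.+1 x = _) => //.
    rewrite e (nc_evalE _ hn) mulr_sumr; apply: eq_bigr => i _.
    by rewrite mulr_sumr.
  rewrite exchange_big; apply: eq_bigr => i _.
  rewrite exchange_big big_seq [RHS]big_seq; apply: eq_bigr => w.
  rewrite mem_words => /eqP sw; rewrite (ncs_ln_sum (n := n)) //; last by rewrite sw ltnW.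
  by rewrite mulr_suml; apply: eq_bigr => l _; rewrite mulrA.
- by move=> y; have [p hp] := X_vanishing y; exists p => l; exact: ev0.
- by move=> l; exact: ev0.
Qed.
End Family.

Hypothesis charK : forall n, n.+1%:R != 0 :> K.
Variables phi1 phi2 : dual E.
Notation L := (ln_at op phi1 phi2).

Lemma schar_nc_eval b : schar (phi_at phi1 phi2 b) = nc_eval L (ncs_exp_letter K b) :> dual _.
Proof.
apply: dual_ext => x; have vL := ln_at_vanishing op_uau sigma_ex phi1 phi2.
have [n hn] := vL x.
pose Q := newton_of op_uau sigma_ex charK (phi_at phi1 phi2 b).
(* A bound that covers both the nonvanishing words at [x] and the degree of the polynomial [Q x]. *)
have hp := word_bound_le (leq_addr (size (Q x)) n) hn.
rewrite (nc_evalE vL _ hp).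
rewrite (schar_exp (op_uau := op_uau) (sigma_ex := sigma_ex) (charK := charK) (leq_addl n _)).
apply: eq_bigr => i _.
rewrite (@sconv_exp_wordc _ _ _ op V _ L b) //.
rewrite -(sum_words_all b i (fun w => i`!%:R^-1 * wordc op L w x)).
rewrite big_seq [RHS]big_seq; apply: eq_bigr => w; rewrite mem_words => /eqP sw.
by rewrite /ncs_exp_letter sw; case: ifP => // _; rewrite mul0r.
Qed.

Lemma ln_op_conv_sigma e :
  ln_op op (conv op phi1 phi2) e =
  CBH op (sdelta (ln_op op phi1)) (sdelta (ln_op op phi2)) (sym_in E e).
Proof.
have vL := ln_at_vanishing op_uau sigma_ex phi1 phi2.
have lL := ln_at_limit op_uau sigma_ex phi1 phi2.
have ln_conv : ln_star op (chr (conv op phi1 phi2)) = nc_eval L (cbh_coef K).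
  rewrite -(schar_conv sigma_ex) (schar_nc_eval false) (schar_nc_eval true).
  rewrite -nc_evalM // nc_eval_ln //.
  (* Both exponentials, and so their product, have constant term 1. *)
  by rewrite /ncs_mul big_ord1 /ncs_exp_letter /= fact0 invr1 mulr1.
have e1 := ln_star_schar op_uau sigma_ex charK phi1.
have e2 := ln_star_schar op_uau sigma_ex charK phi2.
apply: etrans _ (congr2 (fun A B => CBH op A B (sym_in E e)) e1 e2).
apply: etrans (congr1 (fun A => A (sym_in E e)) ln_conv) _.
rewrite /CBH /nc_eval; congr (pfsum _ _); apply/funext => w.
have -> // : wordc op L w =
  sconv_word op (ln_star op (schar phi1)) (ln_star op (schar phi2)) w.
elim: w => [|b w IH] //.
by rewrite [LHS]/(sconv op (L b) (wordc op L w)) IH; case: b.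
Qed.

(** [Delta] is cocommutative: the swap exchanges the two summands of a generator. *)
Lemma conv_comm : uprod_symmetric op -> conv op phi1 phi2 = conv op phi2 phi1.
Proof.
move=> sym_op; apply: functional_ext => i a; rewrite !conv_single sym_op.
rewrite (@pullback_single _ _ (fp2 D D) (fp2 D D)); congr (op D D _ _ (dpow_single i _)).
rewrite -(nhom_compE (fp2_swap D D)); apply: tens_copies_uniq => l v.
rewrite nhom_compE copies_delta_gen linearD addrC.
by congr (_ + _); [exact: fp2_lift_in2|exact: fp2_lift_in1].
Qed.

Lemma ln_star_conv_comm x : conv op phi1 phi2 = conv op phi2 phi1 ->
  ln_star op (schar (conv op phi1 phi2)) x =
  ln_star op (schar phi1) x + ln_star op (schar phi2) x.
Proof.
move=> c12.
pose P1 := convn op phi1; pose P2 := convn op phi2.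
have c2 k : conv op phi2 (P1 k) = conv op (P1 k) phi2.
  elim: k => [|k IH]; first by rewrite [P1 0]/= conv0l // conv0r.
  by rewrite [P1 k.+1]/(conv op phi1 (P1 k)) convA // -c12 -!convA // IH.
have pow k : convn op (conv op phi1 phi2) k = conv op (P1 k) (P2 k).
  elim: k => [|k IH]; first by rewrite conv0l.
  have S phi : convn op phi k.+1 = conv op phi (convn op phi k) by [].
  rewrite S IH /P1 /P2 !S -/(P1 k) -/(P2 k).
  by rewrite -!convA //; congr (conv op phi1 _); rewrite !convA // c2.
pose Q phi := newton_of op_uau sigma_ex charK phi.
have e : Q (conv op phi1 phi2) x = \sum_(p <- cop op x) Q phi1 p.1 * Q phi2 p.2.
  apply: (poly_nat_eq charK) => k; rewrite newton_ofE pow horner_sum.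
  rewrite -(schar_conv sigma_ex) sconvE; apply: eq_bigr => p _.
  by rewrite hornerM !newton_ofE.
apply: etrans (esym (newton_of1 op_uau sigma_ex charK _ x)) _.
rewrite -/(Q _) e coef_sum.
(* The product rule gives the counit convolved with the second logarithm plus the first logarithm
   convolved with the counit. *)
under eq_bigr => p _ do rewrite coefM1 !newton_of0 !newton_of1.
have l1 : char_limit (ln_star op (schar phi1)).
  exact: (ln_at_limit op_uau sigma_ex phi1 phi2 false).
have l2 : char_limit (ln_star op (schar phi2)).
  exact: (ln_at_limit op_uau sigma_ex phi1 phi2 true).
rewrite big_split addrC; congr (_ + _).
  exact: (congr1 (fun A => A x) (sconv1l op_uau sigma_ex l2)).
exact: (congr1 (fun A => A x) (sconv1r op_uau sigma_ex l1)).
Qed.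
End Evaluation.

(* [sigma] is [\0] when no map [s] satisfies [is_sigma]; the coproduct then kills
   the generators, so that every cumulant and both sides of the formula vanish. *)
Section NoSigma.
Variables (K : fieldType) (d m : nat) (op : uprod K d m).
Variable V : lmodType K.
Notation D := (tens_copies m V).
Notation E := (Espace d m V).
Hypothesis no_sigma : ~ exists s, is_sigma op (A1 := D) (A2 := D) s.

Lemma sconv_in0 (A B : dual (sym E)) w : sconv op A B (sym_in E w) = 0.
Proof.
apply: etrans (congr1 (tdual A B) (sym_lift_in _ _)) _.
rewrite /sigma; case: pselect => // _; exact: linear0.
Qed.

Lemma pfsum0 (I : choiceType) (W : lmodType K) (F : I -> dual W) x :
  (forall i, F i x = 0) -> pfsum F x = 0.
Proof.
move=> F0; rewrite /pfsum; case: pselect => // fin.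
by apply: etrans (_ : \sum_(i \in [set: I]) (F i x : K^o) = _) _ => //; exact: fsbig1.
Qed.

Lemma ln_op_no_sigma (phi : dual E) w : ln_op op phi w = 0.
Proof.
apply: pfsum0 => l.
by apply: etrans (congr1 (fun c : K => ln_coef K l.+1 * c) (sconv_in0 _ _ _)) (mulr0 _).
Qed.

Lemma CBH_no_sigma (A B : dual (sym E)) w : CBH op A B (sym_in E w) = 0.
Proof.
apply: pfsum0 => -[|b v].
  (* The empty word stands for the counit; its coefficient is an empty sum. *)
  by apply: etrans (_ : cbh_coef K [::] * _ = 0) => //; rewrite /cbh_coef /ncs_ln big_geq ?mul0r.
by apply: etrans (congr1 (fun c : K => cbh_coef K (b :: v) * c) (sconv_in0 _ _ _)) (mulr0 _).
Qed.
End NoSigma.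

(** * The cumulant formulas, whether or not a map [sigma] exists *)

Section Cumulants.
Variables (K : fieldType) (d m : nat) (op : uprod K d m) (V : lmodType K).
Hypotheses (op_uau : uau op) (charK : forall n, n.+1%:R != 0 :> K).
Variables (phi1 phi2 : dual (Espace d m V)) (x : Espace d m V).

Lemma ln_op_conv :
  ln_op op (conv op phi1 phi2) x =
  CBH op (sdelta (ln_op op phi1)) (sdelta (ln_op op phi2)) (sym_in (Espace d m V) x).
Proof.
case: (pselect (exists s, is_sigma op (A1 := tens_copies m V) (A2 := tens_copies m V) s)) => h.
  exact: ln_op_conv_sigma.
by rewrite (ln_op_no_sigma h) (CBH_no_sigma h).
Qed.

Lemma ln_op_conv_sym : uprod_symmetric op ->
  ln_op op (conv op phi1 phi2) x = ln_op op phi1 x + ln_op op phi2 x.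
Proof.
move=> sym_op.
case: (pselect (exists s, is_sigma op (A1 := tens_copies m V) (A2 := tens_copies m V) s)) => h.
  exact: (ln_star_conv_comm op_uau h charK (sym_in _ x) (conv_comm phi1 phi2 sym_op)).
have ln0 (phi : dual (Espace d m V)) : ln_op op phi x = 0 by rewrite ln_op_no_sigma.
apply: etrans (ln0 (conv op phi1 phi2)) _; apply: esym.
exact: etrans (congr2 +%R (ln0 phi1) (ln0 phi2)) (addr0 _).
Qed.
End Cumulants.

Local Open Scope complex_scope.

Theorem theorem8p1 (R : realType) (d m : nat) (d_gt0 : (0 < d)%N)
    (m_gt0 : (0 < m)%N) (op : uprod R[i] d m) (op_uau : uau op)
    (V : lmodType R[i]) (phi1 phi2 : dual (Espace d m V)) :
  (forall x : Espace d m V,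
     ln_op op (conv op phi1 phi2) x =
     CBH op (sdelta (ln_op op phi1)) (sdelta (ln_op op phi2))
       (sym_in (Espace d m V) x)) /\
  (uprod_symmetric op ->
   forall x : Espace d m V,
     ln_op op (conv op phi1 phi2) x = ln_op op phi1 x + ln_op op phi2 x).
Proof.
have charK n : n.+1%:R != 0 :> R[i] by rewrite Num.Theory.pnatr_eq0.
split=> [x|sym_op x]; first exact: ln_op_conv.
exact: ln_op_conv_sym.
Qed.
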